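(* Consider the model $Y_i=f(x_i)+V^{1/2}(x_i)\xi_i$, $i=0,\dots,n$, with $x_i=i/n$, where $\xi_0,\dots,\xi_n$ are i.i.d. with $E\xi_i=0$, $E\xi_i^2=1$, $E\xi_i^4<\infty$. Suppose $f\in\mathcal{H}_\alpha(M)$ and $V\in\mathcal{H}_\beta(M)$, $V\ge0$, where $\alpha>0$ and $0<\beta<\frac12$. Let $K$ be a kernel as in the context and let $h=C_hn^{-\left(\frac{2}{4\beta+1}\wedge1\right)}$ for a sufficiently large universal constant $C_h>0$. Define $R_i=Y_{i+1}-Y_i$ ($0\le i\le n-1$), $$K_n^h(t)=\frac{\int_{|t|/n}^{(|t|+1)/n}\frac1hK(\frac uh)\,du}{1-\int_{-2/n}^{2/n}\frac1hK(\frac uh)\,du}\,\mathbb{1}_{\{|t|\ge2\}}\quad(t\in\mathbb{Z}),$$ $$\hat T=\frac1n\sum_{\substack{0\le i,j\le n-1\\|i-j|\ge2}}K_n^h(i-j)R_i^2R_j^2-\frac1{n^2}\sum_{\substack{0\le i,j\le n-1\\|i-j|\ge2}}R_i^2R_j^2,$$ and $T=\frac1n\sum_{i=0}^{n-1}(W_i+\delta_i^2-\bar W_n-\overline{\delta^2_n})^2$ where $W_i=V(\frac in)+V(\frac{i+1}n)$, $\delta_i=f(\frac{i+1}n)-f(\frac in)$, $\bar W_n=\frac1n\sum_{i=0}^{n-1}W_i$, $\overline{\delta^2_n}=\frac1n\sum_{i=0}^{n-1}\delta_i^2$. Then $$E_{f,V}\big(|\hat T-T|^2\big)\lesssim n^{-8\alpha}+n^{-4\beta}+n^{-\frac{8\beta}{4\beta+1}}+\frac{\|V-\bar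 V\mathbf 1\|_2^2}{n},$$ where $\bar V=\int_0^1V$, $\mathbf 1$ is the constant function one on $[0,1]$, and the implicit constant does not depend on $n,f,V$.
   Context: $\mathcal{H}_\alpha(M)$: functions $g:[0,1]\to\mathbb{R}$ with $|g^{(\lfloor\alpha\rfloor)}(x)-g^{(\lfloor\alpha\rfloor)}(y)|\le M|x-y|^{\alpha-\lfloor\alpha\rfloor}$ for all $x,y\in[0,1]$ and $\|g^{(k)}\|_\infty\le M$ for $k=0,\dots,\lfloor\alpha\rfloor$; $M$ is a fixed sufficiently large constant. The kernel $K$ is supported on $[-1,1]$, symmetric about $0$, bounded above and below by a universal constant, with $\int_{-1}^1K=1$. $E_{f,V}$ is expectation under the model with mean $f$ and variance $V$. $\|\cdot\|_2$ is the $L^2([0,1])$ norm. $a\lesssim b$ means $a\le Cb$ with $C$ independent of $n,f,V$. *)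

(* Defs.v *)
From HB Require Import structures.
From mathcomp Require Import all_boot all_order all_algebra.
From mathcomp Require Import all_classical all_reals all_analysis.
Set Implicit Arguments. Unset Strict Implicit. Unset Printing Implicit Defensive.
Import Order.TTheory GRing.Theory Num.Theory.
Import numFieldNormedType.Exports.
Local Open Scope classical_set_scope.
Local Open Scope ring_scope.

Section Defs.
Context {R : realType}.

Definition intab (a b : R) (g : R -> R) : R :=
  Rintegral (@lebesgue_measure R) [set x | a <= x <= b] g.

Definition deriv01 (g g' : R -> R) : Prop :=
  forall x : R, 0 <= x <= 1 ->
    (fun y => (g y - g x) / (y - x)) @ within [set y | 0 <= y <= 1 /\ y != x] (nbhs x)
      --> g' x.

Definition holder (a Mc : R) (g : R -> R) : Prop :=
  let m := Num.truncn a in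
  exists gs : nat -> R -> R,
    [/\ gs 0%N = g,
        (forall k, (k < m)%N -> deriv01 (gs k) (gs k.+1)),
        (forall k, (k <= m)%N -> forall x, 0 <= x <= 1 -> `|gs k x| <= Mc) &
        (forall x y, 0 <= x <= 1 -> 0 <= y <= 1 ->
           `|gs m x - gs m y| <= Mc * (`|x - y| `^ (a - m%:R)))].

Definition is_kernel (K : R -> R) : Prop :=
  [/\ measurable_fun setT K,
      (forall x, 1 < `|x| -> K x = 0),
      (forall x, K (- x) = K x),
      (exists c : R, 0 < c /\ forall x, -1 <= x <= 1 -> c <= K x <= c^-1) &
      intab (-1) 1 K = 1].

Definition Knh (K : R -> R) (n : nat) (h : R) (t : int) : R :=
  let d := absz t in
  let Kh := fun u => h^-1 * K (u / h) in
  if (2 <= d)%N then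
    intab (d%:R / n%:R) ((d.+1)%:R / n%:R) Kh /
      (1 - intab (- (2 / n%:R)) (2 / n%:R) Kh)
  else 0.

Definition Yobs {T : Type} (f V : R -> R) (xi : nat -> T -> R) (n i : nat) (w : T) : R :=
  f (i%:R / n%:R) + Num.sqrt (V (i%:R / n%:R)) * xi i w.

Definition Rdiff {T : Type} (f V : R -> R) (xi : nat -> T -> R) (n i : nat) (w : T) : R :=
  Yobs f V xi n i.+1 w - Yobs f V xi n i w.

Definition far (i j : nat) : bool := (2 <= absz (i%:Z - j%:Z))%N.

Definition That {T : Type} (K : R -> R) (h : R) (f V : R -> R) (xi : nat -> T -> R)
    (n : nat) (w : T) : R :=
  n%:R^-1 * \sum_(i < n) \sum_(j < n | far i j)
      Knh K n h (i%:Z - j%:Z) * (Rdiff f V xi n i w) ^+ 2 * (Rdiff f V xi n j w) ^+ 2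
  - (n%:R ^+ 2)^-1 * \sum_(i < n) \sum_(j < n | far i j)
      (Rdiff f V xi n i w) ^+ 2 * (Rdiff f V xi n j w) ^+ 2.

Definition Wi (V : R -> R) (n i : nat) : R := V (i%:R / n%:R) + V (i.+1%:R / n%:R).
Definition deltai (f : R -> R) (n i : nat) : R := f (i.+1%:R / n%:R) - f (i%:R / n%:R).

Definition Tstat (f V : R -> R) (n : nat) : R :=
  let Wbar := n%:R^-1 * \sum_(i < n) Wi V n i in
  let dbar := n%:R^-1 * \sum_(i < n) (deltai f n i) ^+ 2 in
  n%:R^-1 * \sum_(i < n) (Wi V n i + (deltai f n i) ^+ 2 - Wbar - dbar) ^+ 2.

(* mutual independence of a sequence of real random variables
   (product rule for every initial segment; taking B i = setT yields the
   product rule for every finite subfamily) *)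
Definition mutually_independent {d} {T : measurableType d} (P : probability T R)
    (X : nat -> T -> R) : Prop :=
  forall (n : nat) (B : nat -> set R), (forall i, measurable (B i)) ->
    P (\big[setI/setT]_(i < n) (X i @^-1` B i)) =
    (\prod_(i < n) P (X i @^-1` B i))%E.

Definition identically_distributed {d} {T : measurableType d} (P : probability T R)
    (X : nat -> T -> R) : Prop :=
  forall i (B : set R), measurable B -> P (X i @^-1` B) = P (X 0%N @^-1` B).

End Defs.

(* Main.v *)
Require Import Defs.
From HB Require Import structures.
From mathcomp Require Import all_boot all_order all_algebra.
From mathcomp Require Import all_classical all_reals all_analysis.
From mathcomp Require Import measurable_realfun ring lra zify.
Set Implicit Arguments. Unset Strict Implicit. Unset Printing Implicit Defensive.
Import Order.TTheory GRing.Theory Num.Theory.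
Import numFieldNormedType.Exports.
Local Open Scope classical_set_scope.
Local Open Scope ring_scope.

(** Write [m_i = E R_i^2] and [Z_i = R_i^2 - m_i].  The statistic is a quadratic
    form in the [R_i^2] with coefficients [a_ij = K_n^h(i-j)/n - 1/n^2] for
    [|i-j| >= 2], so it splits into its mean, the linear form
    [2 sum_i (sum_j a_ij m_j) Z_i] and the quadratic form [sum a_ij Z_i Z_j].
    The mean differs from [T] by the smoothing error
    [sum K_n^h(i-j) (m_i - m_j)^2 / (2n)], by the boundary defect of the rows of
    [K_n^h], whose total is at most [n h], and by the near-diagonal terms of the
    second sum, which are [O(1/n)].  Each [Z_i] is a combination of products
    [phi p (xi_i) * phi q (xi_{i+1})], [(p, q) <> (0, 0)], with [phi] running
    through [1], [x], [x^2 - 1]; these products are orthogonal as soon as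
    their index sets differ, so [E Z_i Z_k = 0] unless [|i-k| <= 1], and
    [E Z_i Z_j Z_k Z_l = 0] unless [{i, j}] and [{k, l}] match up to distance one.
    Hence both variances are bounded by sums of squared coefficients.  Fourth
    moments suffice because no [xi_m] occurs twice in [Z_i Z_j]. *)

(** * Products of independent variables *)

(** The squared bias contributes [h^(4 beta)] through smoothing, the variance of the quadratic form
    [1 / (n^2 h)]; equating the two gives [h = n^(-2 / (4 beta + 1))] up to a constant, and the rate
    [n^(-8 beta / (4 beta + 1))]. For [beta <= 1/4] such a bandwidth would not exceed the grid
    spacing, hence the cap at [1 / n], which costs [n^(-4 beta)]. The boundary defect and the
    near-diagonal terms contribute [h^2] and [n^(-2)] to the squared bias; both are below the rate
    because [beta < 1/2]. The term [n^(-8 alpha)] is the fourth power of the bound on [delta_i^2],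
    since the smoothing error is quadratic in [m_i - m_j]. The second sum of the statistic centres
    the linear form: its coefficients are about [1 / n] times a local average of [m - mbar], so its
    variance is governed by that of [V] over [n]. With four moments only, expectations are computed
    after expansion into products with one function per noise variable, which independence
    factorises site by site. *)

Section indep_factor.
Context d (T : measurableType d) (R : realType) (P : probability T R).

Import HBNNSimple.

(** Factorisation against indicators of [X] extends to simple functions by linearity and to [g] by
    monotone convergence. In the application [D] is the product of all the other factors. *)
Lemma ge0_integral_indepM (D : T -> R) (X : T -> R) (g : R -> R) :
  measurable_fun setT D -> (forall w, 0 <= D w) ->
  (\int[P]_w (D w)%:E)%E \is a fin_num ->
  measurable_fun setT X ->
  (forall B, measurable B ->
     \int[P]_w (D w * \1_B (X w))%:E = (\int[P]_w (D w)%:E) * P (X @^-1` B))%E ->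
  measurable_fun setT g -> (forall x, 0 <= g x) ->
  (\int[P]_w (D w * g (X w))%:E =
   (\int[P]_w (D w)%:E) * \int[P]_w (g (X w))%:E)%E.
Proof.
move=> mD D0 Dfin mX indep mg g0.
pose g1 : R -> \bar R := EFin \o g.
have mg1 : measurable_fun setT g1 by exact/measurable_EFinP.
pose g_ := nnsfun_approx measurableT mg1.
have g_cvg y : (fun n => (g_ n y)%:E) @ \oo --> (g y)%:E.
  by apply: (cvg_nnsfun_approx measurableT mg1) => // z _; rewrite lee_fin.
have g_nd y : {homo (fun n => g_ n y) : m n / (m <= n)%N >-> m <= n}.
  by move=> m n mn; exact/lefP/nd_nnsfun_approx.
have mgX n : measurable_fun setT (fun w => g_ n (X w)).
  by apply: measurableT_comp => //.
have step n : (\int[P]_w (D w * g_ n (X w))%:E =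
   (\int[P]_w (D w)%:E) * \int[P]_w (g_ n (X w))%:E)%E.
  have mB k : measurable (g_ n @^-1` [set k]) by [].
  have m1 k : measurable_fun setT (fun w => \1_(g_ n @^-1` [set k]) (X w) : R).
    by apply: measurableT_comp => //.
  (* The sums over level sets ask for nonnegative terms at every real [k], also at negative ones;
     there the level set of the nonnegative [g_ n] is empty. *)
  have neg k w : k < 0 -> \1_(g_ n @^-1` [set k]) (X w) = 0 :> R.
    by move=> k0; rewrite preimage_nnfun0// indic0.
  transitivity (\sum_(k \in range (g_ n))
      \int[P]_w (k * (D w * \1_(g_ n @^-1` [set k]) (X w)))%:E)%E.
    rewrite -ge0_integral_fsum//.
    - apply: eq_integral => w _; rewrite fsumEFin// fimfunE; congr _%:E.
      rewrite !fsbig_finite//= mulr_sumr; apply: eq_bigr => k _.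
      by rewrite mulrCA.
    - by move=> k; apply/measurable_EFinP; do 2 apply: measurable_funM => //.
    - move=> k w _; rewrite lee_fin; have [k0|k0] := leP 0 k.
        by rewrite !mulr_ge0// indicE.
      by rewrite neg// !mulr0.
  transitivity (\sum_(k \in range (g_ n))
      ((\int[P]_w (D w)%:E) * \int[P]_w (k * \1_(g_ n @^-1` [set k]) (X w))%:E))%E.
    apply: eq_fsbigr => k _; have [k0|k0] := leP 0 k; last first.
      have -> : (\int[P]_w (k * \1_(g_ n @^-1` [set k]) (X w))%:E = 0)%E.
        by apply: integral0_eq => w _; rewrite neg// mulr0.
      by rewrite mule0; apply: integral0_eq => w _; rewrite neg// !mulr0.
    have ZE (f : T -> R) : measurable_fun setT f -> (forall w, 0 <= f w) ->
        (\int[P]_w (k * f w)%:E = k%:E * \int[P]_w (f w)%:E)%E.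
      move=> mf f0; rewrite -ge0_integralZl//; first exact/measurable_EFinP.
      by move=> w _; rewrite lee_fin.
    rewrite ZE//; last 2 first.
      + exact: measurable_funM.
      + by move=> w; rewrite mulr_ge0// indicE.
    rewrite ZE// indep// muleCA; congr (_ * (_ * _))%E.
    rewrite -[X in P X]setIT -integral_indic//.
    by rewrite -[X in measurable X]setTI; exact: mX.
  rewrite -ge0_mule_fsumr; last first.
    move=> k; apply: integral_ge0 => w _; rewrite lee_fin.
    have [k0|k0] := leP 0 k; first by rewrite !mulr_ge0// indicE.
    by rewrite neg// mulr0.
  congr (_ * _)%E; rewrite -ge0_integral_fsum//.
  - by apply: eq_integral => w _; rewrite fsumEFin// fimfunE.
  - by move=> k; apply/measurable_EFinP; apply: measurable_funM => //.
  - move=> k w _; rewrite lee_fin; have [k0|k0] := leP 0 k.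
      by rewrite !mulr_ge0// indicE.
    by rewrite neg// !mulr0.
have c1 : (\int[P]_w (D w * g_ n (X w))%:E)%E @[n --> \oo] -->
          (\int[P]_w (D w * g (X w))%:E)%E.
  have := @cvg_monotone_convergence _ T R P setT measurableT
    (fun n w => (D w * g_ n (X w))%:E).
  have -> : (fun w => limn (fun n => (D w * g_ n (X w))%:E)) =
            (fun w => (D w * g (X w))%:E).
    apply/funext => w; apply/cvg_lim => //.
    under eq_fun do rewrite EFinM.
    by rewrite EFinM; apply: cvgeZl.
  apply => //.
  - by move=> n; apply/measurable_EFinP/measurable_funM.
  - by move=> n w _; rewrite lee_fin mulr_ge0.
  - by move=> w _ m n mn; rewrite lee_fin ler_wpM2l// g_nd.
have c2 : (\int[P]_w (g_ n (X w))%:E)%E @[n --> \oo] -->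
          (\int[P]_w (g (X w))%:E)%E.
  have := @cvg_monotone_convergence _ T R P setT measurableT
    (fun n w => (g_ n (X w))%:E).
  have -> : (fun w => limn (fun n => (g_ n (X w))%:E)) =
            (fun w => (g (X w))%:E).
    by apply/funext => w; apply/cvg_lim.
  apply => //.
  - by move=> n; apply/measurable_EFinP.
  - by move=> n w _; rewrite lee_fin.
  - by move=> w _ m n mn; rewrite lee_fin g_nd.
have c3 : (\int[P]_w (D w * g_ n (X w))%:E)%E @[n --> \oo] -->
          ((\int[P]_w (D w)%:E) * \int[P]_w (g (X w))%:E)%E.
  by under eq_fun do rewrite step; exact: cvgeZl.
exact: (cvg_unique _ c1 c3).
Qed.

End indep_factor.

Section product_expectation.
Context d (T : measurableType d) (R : realType) (P : probability T R).
Variable X : nat -> T -> R.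
Hypothesis mX : forall i, measurable_fun setT (X i).
Hypothesis iX : mutually_independent P X.

Lemma prod_indic_preimage (N : nat) (B : nat -> set R) w :
  \prod_(i < N) \1_(B i) (X i w) = \1_(\big[setI/setT]_(i < N) (X i @^-1` B i)) w :> R.
Proof.
elim: N => [|N IH]; first by rewrite !big_ord0 indicT.
by rewrite !big_ord_recr/= IH indicI.
Qed.

Lemma integral_indicT_comp (Y : T -> R) :
  (\int[P]_w (\1_(@setT R) (Y w) : R)%:E = 1)%E.
Proof.
rewrite (eq_integral (cst 1%E)); last by move=> w _; rewrite indicT.
by rewrite integral_cst//= mul1e; exact: probability_setT.
Qed.

(** Induction on the number [m] of leading factors that are arbitrary; all later ones are
    indicators. For [m = 0] this is the definition of independence. In the step, factor [m] is
    separated from the product [D] of the others, and the induction hypothesis with [\1_B] at place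
    [m] supplies the factorisation that [ge0_integral_indepM] asks for. *)
Lemma ge0_integral_prod_indep_aux (N m : nat) (g : nat -> R -> R) :
  (forall i, measurable_fun setT (g i)) ->
  (forall i x, 0 <= g i x) ->
  (forall i, (\int[P]_w (g i (X i w))%:E)%E \is a fin_num) ->
  (forall i, (m <= i)%N -> exists2 B, measurable B & g i = \1_B) ->
  (\int[P]_w (\prod_(i < N) g i (X i w))%:E =
   \prod_(i < N) \int[P]_w (g i (X i w))%:E)%E.
Proof.
elim: m g => [|m IH] g mg g0 gfin gB.
  have [B mB gE] : exists2 B : nat -> set R, (forall i, measurable (B i)) &
      forall i, g i = \1_(B i).
    have /choice[B hB] : forall i, exists B, measurable B /\ g i = \1_B.
      by move=> i; have [//|B ? ?] := gB i; exists B.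
    by exists B => i; have [] := hB i.
  have mXB i : measurable (X i @^-1` B i).
    by rewrite -[X in measurable X]setTI; exact: mX.
  have mI : measurable (\big[setI/setT]_(i < N) (X i @^-1` B i)).
    by apply: big_ind => //; exact: measurableI.
  under eq_integral => w _.
    under eq_bigr => i _ do rewrite gE.
    rewrite prod_indic_preimage; over.
  rewrite integral_indic// setIT.
  transitivity (\prod_(i < N) P (X i @^-1` B i))%E; first exact: iX.
  apply: eq_bigr => i _.
  by rewrite gE -[X in P X]setIT -integral_indic.
(* If [N <= m], factor [m] does not occur in the product, and the factors from [m] on may be
   exchanged for [\1_setT]. *)
have [Nm|mN] := leqP N m.
  pose g' i := if (i < m)%N then g i else \1_setT.
  have E (i : 'I_N) : g i = g' i by rewrite /g' (leq_trans (ltn_ord i) Nm).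
  under eq_integral do under eq_bigr do rewrite E.
  under [RHS]eq_bigr do rewrite E.
  apply: IH.
  - by move=> i; rewrite /g'; case: ifP.
  - by move=> i x; rewrite /g'; case: ifP => //; rewrite indicE.
  - move=> i; rewrite /g'; case: ifP => // _.
    by rewrite integral_indicT_comp.
  - by move=> i; rewrite /g' ltnNge => -> /=; exists setT.
pose mo := Ordinal mN.
pose D w := \prod_(i < N | i != mo) g i (X i w).
pose C := (\prod_(i < N | i != mo) \int[P]_w (g i (X i w))%:E)%E.
have mD : measurable_fun setT D.
  rewrite /D; under eq_fun do rewrite -big_filter.
  by apply: measurable_prod => i _; apply: measurableT_comp => //.
have D0 w : 0 <= D w by apply: prodr_ge0.
have DB B : measurable B ->
    (\int[P]_w (D w * \1_B (X m w))%:E = C * P (X m @^-1` B))%E.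
  move=> mB; pose g' i := if i == m then \1_B else g i.
  have mXB : measurable (X m @^-1` B).
    by rewrite -[X in measurable X]setTI; exact: mX.
  have iB : (\int[P]_w (\1_B (X m w))%:E = P (X m @^-1` B))%E.
    by rewrite -[X in P X]setIT -integral_indic.
  have g'E (i : 'I_N) : i != mo -> g' i = g i.
    by move=> im; rewrite /g'; case: eqP => // h; case/eqP: im; apply: val_inj.
  have g'm : g' m = \1_B by rewrite /g' eqxx.
  have := IH g'; rewrite (bigD1 mo)//= g'm iB => IH'.
  rewrite muleC; move: IH'.
  under [X in (_ -> _ -> _ -> _ -> _ = _ * X)%E]eq_bigr => i im do rewrite g'E//.
  move=> <-.
  - apply: eq_integral => w _; rewrite (bigD1 mo)//= g'm mulrC.
    by congr (_ * _)%:E; apply: eq_bigr => i im; rewrite g'E.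
  - by move=> i; rewrite /g'; case: ifP => // _; exact: measurable_indic.
  - by move=> i x; rewrite /g'; case: ifP => // _; rewrite indicE.
  - by move=> i; rewrite /g'; case: eqP => // ->; rewrite iB fin_num_measure.
  - move=> i mi; rewrite /g'; case: eqP => [_|/eqP im]; first by exists B.
    by apply: gB; rewrite ltn_neqAle eq_sym im.
(* The case [B = setT] of [DB]. *)
have DE : (\int[P]_w (D w)%:E = C)%E.
  have := DB _ measurableT; rewrite preimage_setT probability_setT mule1 => <-.
  by apply: eq_integral => w _; rewrite indicT mulr1.
rewrite (bigD1 mo)//= -/C muleC -DE -ge0_integral_indepM//; last 2 first.
- by rewrite DE; apply: prode_fin_num.
- by move=> B mB; rewrite DB// DE.
by apply: eq_integral => w _; rewrite (bigD1 mo)//= mulrC.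
Qed.

Lemma ge0_integral_prod_indep (N : nat) (g : nat -> R -> R) :
  (forall i, measurable_fun setT (g i)) ->
  (forall i x, 0 <= g i x) ->
  (forall i, (\int[P]_w (g i (X i w))%:E)%E \is a fin_num) ->
  (\int[P]_w (\prod_(i < N) g i (X i w))%:E =
   \prod_(i < N) \int[P]_w (g i (X i w))%:E)%E.
Proof.
move=> mg g0 gfin; pose g' i := if (i < N)%N then g i else \1_setT.
have E (i : 'I_N) : g i = g' i by rewrite /g' ltn_ord.
under eq_integral do under eq_bigr do rewrite E.
under [RHS]eq_bigr do rewrite E.
apply: (@ge0_integral_prod_indep_aux N N).
- by move=> i; rewrite /g'; case: ifP.
- by move=> i x; rewrite /g'; case: ifP => //; rewrite indicE.
- move=> i; rewrite /g'; case: ifP => // _.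
  by rewrite integral_indicT_comp.
- by move=> i; rewrite /g' ltnNge => -> /=; exists setT.
Qed.


(** The absolute values factorise as well, so the integral of the norm is a finite product.
    Integrability of the single factors is therefore enough, however many there are. *)
Lemma integrable_prod_indep (N : nat) (g : nat -> R -> R) :
  (forall i, measurable_fun setT (g i)) ->
  (forall i, P.-integrable setT (fun w => (g i (X i w))%:E)) ->
  P.-integrable setT (fun w => (\prod_(i < N) g i (X i w))%:E).
Proof.
move=> mg ig; apply/integrableP; split.
  apply/measurable_EFinP; apply: measurable_prod => i _.
  by apply: measurableT_comp => //.
have gfin i : (\int[P]_w (`|g i (X i w)|)%:E)%E \is a fin_num.
  apply: integrable_fin_num => //.
  exact: (integrable_norm (ig i)).
rewrite (eq_integral (fun w => (\prod_(i < N) `|g i (X i w)|)%:E)); last first.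
  by move=> w _; rewrite abse_EFin normr_prod.
rewrite (@ge0_integral_prod_indep N (fun i x => `|g i x|))//.
  by rewrite ltey_eq prode_fin_num.
by move=> i; apply: measurableT_comp.
Qed.

Lemma fine_prode (I : Type) (s : seq I) (F : I -> \bar R) :
  (forall i, F i \is a fin_num) ->
  fine (\prod_(i <- s) F i)%E = \prod_(i <- s) fine (F i).
Proof.
move=> Ff; elim: s => [|i s IH]; first by rewrite !big_nil.
by rewrite !big_cons fineM ?IH//; exact: prode_fin_num.
Qed.

(** Induction on the number [m] of leading factors of arbitrary sign, the later ones being
    nonnegative. The product is linear in factor [m], which is split into its positive part [gp] and
    its negative part [gn]; [up k] is the family with [k] at place [m]. *)
Lemma Rintegral_prod_indep (N : nat) (g : nat -> R -> R) :
  (forall i, measurable_fun setT (g i)) ->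
  (forall i, P.-integrable setT (fun w => (g i (X i w))%:E)) ->
  \int[P]_w (\prod_(i < N) g i (X i w)) =
  \prod_(i < N) \int[P]_w (g i (X i w)).
Proof.
move=> mg ig.
suff H (m : nat) (f : nat -> R -> R) : (forall i, measurable_fun setT (f i)) ->
    (forall i, P.-integrable setT (fun w => (f i (X i w))%:E)) ->
    (forall i, (m <= i < N)%N -> forall x, 0 <= f i x) ->
    \int[P]_w (\prod_(i < N) f i (X i w)) =
    \prod_(i < N) \int[P]_w (f i (X i w)).
  by apply: (H N) => // i /andP[]; rewrite leqNgt => /negbTE ->.
elim: m f => [|m IH] f mf jf f0.
  pose f' i := if (i < N)%N then f i else \1_setT.
  have E (i : 'I_N) : f i = f' i by rewrite /f' ltn_ord.
  under eq_Rintegral do under eq_bigr do rewrite E.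
  under [RHS]eq_bigr do rewrite E.
  have mf' i : measurable_fun setT (f' i) by rewrite /f'; case: ifP.
  have fin' i : (\int[P]_w (f' i (X i w))%:E)%E \is a fin_num.
    rewrite /f'; case: ifP => _; first exact: integrable_fin_num.
    by rewrite integral_indicT_comp.
  rewrite /Rintegral ge0_integral_prod_indep//.
    by rewrite fine_prode.
  move=> i x; rewrite /f'; case: ifP => iN; last by rewrite indicE.
  by apply: f0.
have [Nm|mN] := leqP N m.
  by apply: IH => // i /andP[mi iN]; rewrite ltnNge (leq_trans Nm mi) in iN.
pose mo := Ordinal mN.
pose up k i := if i == m then k else f i.
pose gp x := Num.max (f m x) 0.
pose gn x := Num.max (- f m x) 0.
have upE (k : R -> R) (F : nat -> (R -> R) -> R) :
    \prod_(i < N) F i (up k i) = F m k * \prod_(i < N | i != mo) F i (f i).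
  rewrite (bigD1 mo)//= {1}/up eqxx; congr (_ * _); apply: eq_bigr => i im.
  rewrite /up; case: eqP => // h; case/eqP: im; exact: val_inj.
have fE : f = up (f m) by apply/funext => i; rewrite /up; case: eqP => [->|].
have mpos (k : R -> R) : measurable_fun setT k ->
    measurable_fun setT (fun x : R => Num.max (k x) 0 : R).
  by move=> mg'; exact: measurable_maxr.
have ipos (k : R -> R) : measurable_fun setT k ->
    P.-integrable setT (fun w => (k (X m w))%:E) ->
    P.-integrable setT (fun w => (Num.max (k (X m w)) 0)%:E).
  move=> mg' ig'; apply: le_integrable ig' => //.
    apply/measurable_EFinP; apply: (measurableT_comp (mpos _ mg')) => //.
  move=> w _; rewrite !abse_EFin lee_fin ger0_norm ?le_max ?lexx ?orbT//.
  by rewrite ge_max ler_norm normr_ge0.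
have mgn' : measurable_fun setT (fun x => - f m x) by exact: measurableT_comp.
have ign' : P.-integrable setT (fun w => (- f m (X m w))%:E).
  rewrite (_ : (fun _ => _) = (fun w => - (f m (X m w))%:E)%E)//.
  exact: integrableN.
have mgp : measurable_fun setT gp by exact: mpos.
have mgn : measurable_fun setT gn by exact: mpos.
have igp : P.-integrable setT (fun w => (gp (X m w))%:E) by exact: ipos.
have ign : P.-integrable setT (fun w => (gn (X m w))%:E) by exact: (ipos (fun x => - f m x)).
have fmE x : f m x = gp x - gn x.
  rewrite /gp /gn; case: (leP (f m x) 0) => h; case: (leP (- f m x) 0) => h'; lra.
have mup (k : R -> R) : measurable_fun setT k -> forall i, measurable_fun setT (up k i).
  by move=> mg' i; rewrite /up; case: ifP.
have iup (k : R -> R) : P.-integrable setT (fun w => (k (X m w))%:E) ->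
    forall i, P.-integrable setT (fun w => (up k i (X i w))%:E).
  by move=> ig' i; rewrite /up; case: eqP => [->|].
have pup (k : R -> R) : (forall x, 0 <= k x) ->
    forall i, (m <= i < N)%N -> forall x, 0 <= up k i x.
  move=> g0 i /andP[mi iN] x; rewrite /up; case: eqP => // /eqP im.
  by apply: f0; rewrite ltn_neqAle eq_sym im mi.
transitivity (\int[P]_w (\prod_(i < N) up gp i (X i w)
                         - \prod_(i < N) up gn i (X i w))).
  apply: eq_Rintegral => w _; rewrite fE.
  by rewrite !(upE _ (fun i k => k (X i w))) -mulrBl fmE.
rewrite RintegralB//; last 2 first.
- by apply: integrable_prod_indep => //; [exact: mup|exact: iup].
- by apply: integrable_prod_indep => //; [exact: mup|exact: iup].
rewrite !IH; [| exact: mup|exact: iup|by apply: pup => x; rewrite le_max lexx orbT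
  |exact: mup|exact: iup|by apply: pup => x; rewrite le_max lexx orbT].
rewrite [in RHS]fE !(upE _ (fun i k => \int[P]_w k (X i w))) -mulrBl -RintegralB//.
by congr (_ * _); apply: eq_Rintegral => w _; rewrite fmE.
Qed.

End product_expectation.

(** * Orthogonal tensors of the noise *)

Section iid_moments.
Context d (T : measurableType d) (R : realType) (P : probability T R).
Variable X : nat -> T -> R.
Hypothesis mX : forall i, measurable_fun setT (X i).
Hypothesis idX : identically_distributed P X.

Lemma ge0_integral_iid (g : R -> R) (i : nat) :
  measurable_fun setT g -> (forall x, 0 <= g x) ->
  (\int[P]_w (g (X i w))%:E = \int[P]_w (g (X 0%N w))%:E)%E.
Proof.
move=> mg g0.
have mgE : measurable_fun setT (fun x => (g x)%:E) by exact/measurable_EFinP.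
have pf j : (\int[P]_w (g (X j w))%:E = \int[pushforward P (X j)]_x (g x)%:E)%E.
  rewrite (ge0_integral_pushforward (mX j))//.
  by move=> x _; rewrite lee_fin.
rewrite !pf; apply: eq_measure_integral => A mA _; exact: idX.
Qed.

Lemma integrable_iid (g : R -> R) (i : nat) :
  measurable_fun setT g ->
  P.-integrable setT (fun w => (g (X 0%N w))%:E) ->
  P.-integrable setT (fun w => (g (X i w))%:E).
Proof.
move=> mg /integrableP[_ h]; apply/integrableP; split.
  by apply/measurable_EFinP; apply: measurableT_comp => //.
under eq_integral do rewrite abse_EFin.
rewrite (ge0_integral_iid (g := fun x => `|g x|))//.
exact: measurableT_comp.
Qed.

Lemma Rintegral_iid (g : R -> R) (i : nat) :
  measurable_fun setT g ->
  P.-integrable setT (fun w => (g (X 0%N w))%:E) ->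
  \int[P]_w (g (X i w)) = \int[P]_w (g (X 0%N w)).
Proof.
move=> mg ig; rewrite /Rintegral; congr fine.
have mgE : measurable_fun setT (fun x => (g x)%:E) by exact/measurable_EFinP.
have pf j : (\int[P]_w (g (X j w))%:E = \int[pushforward P (X j)]_x (g x)%:E)%E.
  rewrite (integral_pushforward (mX j))//.
  exact: integrable_iid.
rewrite !pf; apply: eq_measure_integral => A mA _; exact: idX.
Qed.

End iid_moments.

Lemma Rintegral_cst_prob d (T : measurableType d) (R : realType)
  (P : probability T R) (r : R) : \int[P]_(w in setT) r = r.
Proof.
rewrite Rintegral_cst//; have -> : fine (P setT) = 1 by rewrite probability_setT.
exact: mulr1.
Qed.

Section phi.
Context d (T : measurableType d) (R : realType) (P : probability T R).
Variable X : nat -> T -> R.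
Hypothesis mX : forall i, measurable_fun setT (X i).
Hypothesis iX : mutually_independent P X.
Hypothesis idX : identically_distributed P X.
Hypothesis X1 : (\int[P]_w (X 0%N w)%:E = 0)%E.
Hypothesis X2 : (\int[P]_w ((X 0%N w) ^+ 2)%:E = 1)%E.
Hypothesis X4 : (\int[P]_w ((X 0%N w) ^+ 4)%:E < +oo)%E.

(** [phi 1] and [phi 2] are centred because the noise has mean zero and variance one. They may be
    correlated with each other, as the third moment is free, so only a site where exactly one of two
    exponents is zero yields orthogonality. *)
Definition phi (p : nat) (x : R) : R :=
  match p with 0%N => 1 | 1%N => x | _ => x ^+ 2 - 1 end.

Lemma measurable_phi p : measurable_fun setT (phi p).
Proof.
case: p => [|[|p]] /=; [exact: measurable_cst|exact: measurable_id|].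
by apply: measurable_funB => //; exact: measurable_funX.
Qed.

(** The entry point of the fourth moment: each square [phi r x ^+ 2] is dominated by it, and
    [|a b| <= (a^2 + b^2) / 2] covers the mixed products. *)
Lemma phiM_bound p q (x : R) : `|phi p x * phi q x| <= 2 * (1 + x ^+ 4).
Proof.
have h r : phi r x ^+ 2 <= 2 * (1 + x ^+ 4).
  have := sqr_ge0 (x ^+ 2 - 1); have := sqr_ge0 (x ^+ 2).
  have := sqr_ge0 (x ^+ 2 + 1); have := sqr_ge0 x.
  rewrite -!exprM /=; case: r => [|[|r]] /=.
  - rewrite expr1n; lra.
  - nra.
  - nra.
have := h p; have := h q.
move: (phi p x) (phi q x) (x ^+ 4) => a b c h1 h2.
have := sqr_ge0 (a - b); have := sqr_ge0 (a + b).
rewrite ler_norml; nra.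
Qed.

Lemma integrable_phiM p q i :
  P.-integrable setT (fun w => (phi p (X i w) * phi q (X i w))%:E).
Proof.
apply: (integrable_iid mX idX (g := fun x => phi p x * phi q x)).
  by apply: measurable_funM; exact: measurable_phi.
have i4 : P.-integrable setT (fun w => (X 0%N w ^+ 4)%:E).
  apply/integrableP; split.
    by apply/measurable_EFinP; exact: measurable_funX.
  under eq_integral do rewrite abse_EFin ger0_norm ?exprn_even_ge0//.
  by [].
have ib : P.-integrable setT (fun w => 2%:E * (1%:E + (X 0%N w ^+ 4)%:E))%E.
  apply: integrableZl => //; apply: integrableD => //.
  exact: finite_measure_integrable_cst.
apply: le_integrable ib => //.
  apply/measurable_EFinP; apply: measurable_funM;
    exact: (measurableT_comp (measurable_phi _)).
move=> w _; rewrite -EFinD -EFinM !abse_EFin lee_fin.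
apply: le_trans (phiM_bound _ _ _) _; exact: ler_norm.
Qed.

Lemma integrable_phi p i : P.-integrable setT (fun w => (phi p (X i w))%:E).
Proof.
have := integrable_phiM p 0 i.
by under eq_fun do rewrite mulr1.
Qed.

Lemma mean_phi p i : (0 < p)%N -> \int[P]_w (phi p (X i w)) = 0.
Proof.
move=> p0; rewrite (Rintegral_iid mX idX)//; last 2 first.
- exact: measurable_phi.
- exact: integrable_phi.
case: p p0 => [//|[|p]] _ /=; first by rewrite /Rintegral X1.
have i2 : P.-integrable setT (fun w => (X 0%N w ^+ 2)%:E).
  apply/integrableP; split.
    by apply/measurable_EFinP; exact: measurable_funX.
  under eq_integral do rewrite abse_EFin ger0_norm ?exprn_even_ge0//.
  by rewrite X2 ltry.
rewrite RintegralB//; last exact: finite_measure_integrable_cst.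
by rewrite Rintegral_cst_prob {1}/Rintegral X2 subrr.
Qed.

(** The sum of the second moments of [phi 0], [phi 1] and [phi 2], hence a common bound for them.
    The law of the noise enters the final constant through this number alone. *)
Definition phi_bound : R :=
  1 + \int[P]_w (phi 1 (X 0%N w) ^+ 2) + \int[P]_w (phi 2 (X 0%N w) ^+ 2).

Lemma phi_bound_ge1 : 1 <= phi_bound.
Proof.
rewrite /phi_bound -addrA lerDl addr_ge0// Rintegral_ge0// => w _; exact: sqr_ge0.
Qed.

Lemma phi2_bound p i : \int[P]_w (phi p (X i w) ^+ 2) <= phi_bound.
Proof.
have -> : \int[P]_w (phi p (X i w) ^+ 2) = \int[P]_w (phi p (X 0%N w) ^+ 2).
  apply: (Rintegral_iid mX idX (g := fun x => phi p x ^+ 2)).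
    by apply: measurable_funX; exact: measurable_phi.
  exact: integrable_phiM.
have p0 q : 0 <= \int[P]_w (phi q (X 0%N w) ^+ 2).
  by apply: Rintegral_ge0 => w _; exact: sqr_ge0.
have := p0 1%N; have := p0 2%N.
rewrite /phi_bound; case: p => [|[|p]] /=; last 2 first.
- lra.
- lra.
rewrite expr1n.
rewrite Rintegral_cst_prob /=; lra.
Qed.

Lemma phi0_mean i : \int[P]_w (phi 0 (X i w) ^+ 2) = 1.
Proof.
rewrite /= expr1n.
by rewrite Rintegral_cst_prob.
Qed.

End phi.

Lemma farE (i j : nat) : far i j = (i.+2 <= j)%N || (j.+2 <= i)%N.
Proof. rewrite /far; lia. Qed.

(** * Second moments of linear combinations *)

Section linear_combinations.
Context d (T : measurableType d) (R : realType) (P : probability T R).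

Lemma integrable_lin (I : Type) (s : seq I) (x : I -> R) (F : I -> T -> R) :
  (forall a, P.-integrable setT (fun w => (F a w)%:E)) ->
  P.-integrable setT (fun w => (\sum_(a <- s) x a * F a w)%:E).
Proof.
move=> iF; under eq_fun do rewrite -sumEFin.
apply: integrable_sum => // a _.
under eq_fun do rewrite EFinM.
exact: integrableZl.
Qed.

Lemma Rintegral_lin (I : Type) (s : seq I) (x : I -> R) (F : I -> T -> R) :
  (forall a, P.-integrable setT (fun w => (F a w)%:E)) ->
  \int[P]_w (\sum_(a <- s) x a * F a w) = \sum_(a <- s) x a * \int[P]_w (F a w).
Proof.
move=> iF; elim: s => [|a s IH].
  under eq_Rintegral do rewrite big_nil.
  by rewrite big_nil Rintegral_cst_prob.
under eq_Rintegral do rewrite big_cons.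
have i1 : P.-integrable setT (fun w => (x a * F a w)%:E).
  by under eq_fun do rewrite EFinM; exact: integrableZl.
rewrite big_cons RintegralD//; last exact: integrable_lin.
by rewrite IH RintegralZl//; exact: iF.
Qed.

Lemma mul_lin (I J : Type) (s : seq I) (t : seq J) (x : I -> R) (y : J -> R)
    (F : I -> R) (G : J -> R) :
  (\sum_(a <- s) x a * F a) * (\sum_(b <- t) y b * G b) =
  \sum_(p <- [seq (a, b) | a <- s, b <- t]) (x p.1 * y p.2) * (F p.1 * G p.2).
Proof.
rewrite big_allpairs mulr_suml; apply: eq_bigr => a _.
by rewrite mulr_sumr; apply: eq_bigr => b _ /=; rewrite mulrACA.
Qed.

(* Schur test with the 0/1 kernel [r]. *)
Lemma quad_form_le (I : finType) (C : R) (D : nat) (r : rel I) (a : I -> R)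
    (X : I -> T -> R) :
  (forall s t, P.-integrable setT (fun w => (X s w * X t w)%:E)) ->
  (forall s t, `|\int[P]_w (X s w * X t w)| <= C * (r s t)%:R) ->
  0 <= C -> symmetric r -> (forall s, (\sum_t r s t <= D)%N) ->
  \int[P]_w ((\sum_s a s * X s w) ^+ 2) <= C * D%:R * \sum_s a s ^+ 2.
Proof.
move=> iX bX C0 sr cr.
under eq_Rintegral do rewrite expr2 mul_lin.
rewrite (Rintegral_lin _ (fun p => a p.1 * a p.2) (fun p => iX p.1 p.2)).
rewrite big_allpairs/=.
pose A s := a s ^+ 2.
apply: (@le_trans _ _ (\sum_s \sum_t (C * ((A s + A t) / 2)) * (r s t)%:R)).
  apply: ler_sum => s _; apply: ler_sum => t _.
  apply: le_trans (ler_norm _) _; rewrite normrM.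
  rewrite [leRHS](_ : _ = (A s + A t) / 2 * (C * (r s t)%:R)); last by ring.
  apply: ler_pM => //.
  rewrite /A ler_norml; have := sqr_ge0 (a s + a t); have := sqr_ge0 (a s - a t).
  move: (a s) (a t) => u v; nra.
have -> : \sum_s \sum_t C * ((A s + A t) / 2) * (r s t)%:R =
          \sum_s \sum_t C * A s * (r s t)%:R.
  have e : \sum_s \sum_t C * A t * (r s t)%:R = \sum_s \sum_t C * A s * (r s t)%:R.
    rewrite exchange_big/=; apply: eq_bigr => s _; apply: eq_bigr => t _.
    by rewrite sr.
  transitivity ((\sum_s \sum_t C * A s * (r s t)%:R
                + \sum_s \sum_t C * A t * (r s t)%:R) / 2); last by rewrite e; field.
  rewrite -big_split/= mulr_suml; apply: eq_bigr => s _.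
  by rewrite -big_split/= mulr_suml; apply: eq_bigr => t _; field.
rewrite mulr_sumr; apply: ler_sum => s _.
have h : \sum_t (r s t)%:R <= D%:R :> R.
  by rewrite -(natr_sum R _ _ (fun t => r s t : nat)) ler_nat; exact: cr.
by rewrite -mulr_sumr [leRHS]mulrAC ler_wpM2l// mulr_ge0// sqr_ge0.
Qed.

End linear_combinations.

Section patterns.
Variables (T : Type) (R : realType) (X : nat -> T -> R) (N : nat).

Definition tensor (e : nat -> nat) (w : T) : R := \prod_(m < N) phi (e m) (X m w).

Lemma tensorM e e' w :
  tensor e w * tensor e' w = \prod_(m < N) (phi (e m) (X m w) * phi (e' m) (X m w)).
Proof. by rewrite -big_split. Qed.

(* The exponent pattern of [phi u.1 (X i) * phi u.2 (X i.+1)]. *)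
Definition pat (i : nat) (u : nat * nat) (m : nat) : nat :=
  if m == i then u.1 else if m == i.+1 then u.2 else 0%N.

(** The family [h] is general because it serves twice: for the values [phi p (X m w)] and for their
    second moments. Both are 1 at exponent zero, which removes all sites but [i] and [i.+1]. *)
Lemma prod_pat (h : nat -> nat -> R) i u :
  (forall m, h m 0%N = 1) -> (i.+1 < N)%N ->
  \prod_(m < N) h m (pat i u m) = h i u.1 * h i.+1 u.2.
Proof.
move=> h0 iN; have iN' := ltnW iN.
rewrite (bigD1 (Ordinal iN'))//= (bigD1 (Ordinal iN))/=; last first.
  by rewrite -val_eqE /= -[X in _ == X]addn0 -addn1 eqn_add2l.
rewrite big1 ?mulr1; last first.
  move=> m /andP[]; rewrite -!val_eqE/= => m1 m2.
  by rewrite /pat (negbTE m1) (negbTE m2) h0.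
by rewrite /pat !eqxx -[X in X == i]addn1 -[X in _ == X]addn0 eqn_add2l.
Qed.

Lemma far_pat i j u v m : far i j -> pat i u m = 0%N \/ pat j v m = 0%N.
Proof.
rewrite farE /pat => h.
case: eqP => [->|_]; [right|case: eqP => [->|_]; [right|by left]];
  by case: eqP => [|_]; [lia|case: eqP => //; lia].
Qed.

(** Exponents add. For far [i] and [j] the supports [{i, i+1}] and [{j, j+1}] are disjoint, so at
    most one summand is nonzero at each site and the tensor of the sum is the product of the
    tensors. This is how the restriction [|i - j| >= 2] of the statistic is exploited. *)
Definition pat2 i u j v m := (pat i u m + pat j v m)%N.

Lemma prod_pat2 (h : nat -> nat -> R) i u j v :
  (forall m, h m 0%N = 1) -> (i.+1 < N)%N -> (j.+1 < N)%N -> far i j ->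
  \prod_(m < N) h m (pat2 i u j v m) = (h i u.1 * h i.+1 u.2) * (h j v.1 * h j.+1 v.2).
Proof.
move=> h0 iN jN fij.
rewrite -(prod_pat u h0 iN) -(prod_pat v h0 jN) -big_split/=; apply: eq_bigr => m _.
by rewrite /pat2; have [->|->] := far_pat u v m fij; rewrite ?addn0 ?add0n h0 ?mul1r ?mulr1.
Qed.

Lemma tensor_pat w i u : (i.+1 < N)%N ->
  tensor (pat i u) w = phi u.1 (X i w) * phi u.2 (X i.+1 w).
Proof. by move=> iN; rewrite /tensor (prod_pat (h := fun m p => phi p (X m w))). Qed.

Lemma tensor_pat2 w i u j v : (i.+1 < N)%N -> (j.+1 < N)%N -> far i j ->
  tensor (pat2 i u j v) w = tensor (pat i u) w * tensor (pat j v) w.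
Proof.
move=> iN jN fij; rewrite !tensor_pat// /tensor.
by rewrite (prod_pat2 (h := fun m p => phi p (X m w))).
Qed.

End patterns.

Section tensors.
Context d (T : measurableType d) (R : realType) (P : probability T R).
Variable X : nat -> T -> R.
Hypothesis mX : forall i, measurable_fun setT (X i).
Hypothesis iX : mutually_independent P X.
Hypothesis idX : identically_distributed P X.
Hypothesis X1 : (\int[P]_w (X 0%N w)%:E = 0)%E.
Hypothesis X2 : (\int[P]_w ((X 0%N w) ^+ 2)%:E = 1)%E.
Hypothesis X4 : (\int[P]_w ((X 0%N w) ^+ 4)%:E < +oo)%E.
Variable N : nat.
Let tensor := tensor X N.

Lemma measurable_phiM p q : measurable_fun setT (fun x : R => phi p x * phi q x).
Proof. by apply: measurable_funM; exact: measurable_phi. Qed.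

Lemma integrable_tensorM e e' :
  P.-integrable setT (fun w => (tensor e w * tensor e' w)%:E).
Proof.
under eq_fun do rewrite tensorM.
apply: (@integrable_prod_indep _ _ _ _ X mX iX N (fun m x => phi (e m) x * phi (e' m) x)).
  by move=> m; exact: measurable_phiM.
by move=> m; exact: integrable_phiM.
Qed.

Lemma Rintegral_tensorM e e' :
  \int[P]_w (tensor e w * tensor e' w) =
  \prod_(m < N) \int[P]_w (phi (e m) (X m w) * phi (e' m) (X m w)).
Proof.
under eq_Rintegral do rewrite tensorM.
apply: (@Rintegral_prod_indep _ _ _ _ X mX iX N (fun m x => phi (e m) x * phi (e' m) x)).
  by move=> m; exact: measurable_phiM.
by move=> m; exact: integrable_phiM.
Qed.

(** One site suffices: at [m] the factor of the expectation is the mean of some [phi p] with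
    [p > 0], which vanishes. *)
Lemma tensor_orth e e' m : (m < N)%N -> (0 < e m)%N -> e' m = 0%N ->
  \int[P]_w (tensor e w * tensor e' w) = 0.
Proof.
move=> mN em e'm; rewrite Rintegral_tensorM (bigD1 (Ordinal mN))//= e'm.
under eq_Rintegral do rewrite mulr1.
by rewrite mean_phi// mul0r.
Qed.

Let B := phi_bound P X.

(** The inequality [|x y| <= (x^2 + y^2) / 2] under the integral replaces Cauchy-Schwarz, since both
    second moments have the same bound. *)
Lemma tensor_norm_le e e' (b : R) :
  \int[P]_w (tensor e w * tensor e w) <= b ->
  \int[P]_w (tensor e' w * tensor e' w) <= b ->
  `|\int[P]_w (tensor e w * tensor e' w)| <= b.
Proof.
move=> h h'.
have i1 := integrable_tensorM e e; have i2 := integrable_tensorM e' e'.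
have i3 := integrable_tensorM e e'.
have iZ (f : T -> R) : P.-integrable setT (EFin \o f) ->
    P.-integrable setT (EFin \o (fun w => 2^-1 * f w)).
  by move=> jf; exact: (integrableZl measurableT 2^-1 jf).
apply: le_trans (le_normr_Rintegral _ _) _ => //.
apply: (@le_trans _ _ (\int[P]_w (2^-1 * (tensor e w * tensor e w)
                                + 2^-1 * (tensor e' w * tensor e' w)))); last first.
  rewrite RintegralD//; last 2 first.
  - exact: (iZ _ i1).
  - exact: (iZ _ i2).
  rewrite !RintegralZl//; lra.
apply: le_Rintegral => //.
- exact: (integrable_norm i3).
- exact: (integrableD measurableT (iZ _ i1) (iZ _ i2)).
move=> w _; move: (tensor e w) (tensor e' w) => x y.
rewrite ler_norml; have := sqr_ge0 (x - y); have := sqr_ge0 (x + y); nra.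
Qed.

Lemma tensor_pat_le i u : (i.+1 < N)%N ->
  \int[P]_w (tensor (pat i u) w * tensor (pat i u) w) <= B ^+ 2.
Proof.
move=> iN; rewrite Rintegral_tensorM.
pose h m p := \int[P]_w (phi p (X m w) ^+ 2).
rewrite (prod_pat (h := h))// => [|m]; last exact: phi0_mean.
rewrite expr2; apply: ler_pM.
- by apply: Rintegral_ge0 => w _; exact: sqr_ge0.
- by apply: Rintegral_ge0 => w _; exact: sqr_ge0.
- exact: phi2_bound.
- exact: phi2_bound.
Qed.

Lemma tensor_pat2_le i u j v : (i.+1 < N)%N -> (j.+1 < N)%N -> far i j ->
  \int[P]_w (tensor (pat2 i u j v) w * tensor (pat2 i u j v) w) <= B ^+ 4.
Proof.
move=> iN jN fij; rewrite Rintegral_tensorM.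
pose h m p := \int[P]_w (phi p (X m w) ^+ 2).
have h0 m p : 0 <= h m p by apply: Rintegral_ge0 => w _; exact: sqr_ge0.
rewrite (prod_pat2 (h := h))// => [|m]; last exact: phi0_mean.
rewrite (_ : B ^+ 4 = (B * B) * (B * B)); last by ring.
by apply: ler_pM; rewrite ?mulr_ge0//; apply: ler_pM => //; exact: phi2_bound.
Qed.

End tensors.

Section products_of_combinations.
Context d (T : measurableType d) (R : realType) (P : probability T R).

Lemma norm_sum_seq_le (I : eqType) (s : seq I) (z : I -> R) (C : R) :
  (forall a, a \in s -> `|z a| <= C) -> `|\sum_(a <- s) z a| <= (size s)%:R * C.
Proof.
elim: s => [|a s IH] h; first by rewrite big_nil normr0 mul0r.
rewrite big_cons; apply: le_trans (ler_normD _ _) _.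
rewrite -[size (a :: s)]/(size s).+1 -add1n natrD mulrDl mul1r lerD//.
  by apply: h; rewrite mem_head.
by apply: IH => b bs; apply: h; rewrite inE bs orbT.
Qed.

Section two_combinations.
Context (I J : Type) (s : seq I) (t : seq J) (x : I -> R) (y : J -> R)
  (F : I -> T -> R) (G : J -> T -> R).
Hypothesis iFG : forall a b, P.-integrable setT (fun w => (F a w * G b w)%:E).

Lemma integrable_mul_lin : P.-integrable setT
  (fun w => ((\sum_(a <- s) x a * F a w) * (\sum_(b <- t) y b * G b w))%:E).
Proof.
under eq_fun do rewrite mul_lin.
exact: (integrable_lin _ (fun p => x p.1 * y p.2) (fun p => iFG p.1 p.2)).
Qed.

Lemma Rintegral_mul_lin :
  \int[P]_w ((\sum_(a <- s) x a * F a w) * (\sum_(b <- t) y b * G b w)) =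
  \sum_(p <- [seq (a, b) | a <- s, b <- t])
     (x p.1 * y p.2) * \int[P]_w (F p.1 w * G p.2 w).
Proof.
under eq_Rintegral do rewrite mul_lin.
exact: (Rintegral_lin _ (fun p => x p.1 * y p.2) (fun p => iFG p.1 p.2)).
Qed.

End two_combinations.
End products_of_combinations.

Section near.
Local Open Scope nat_scope.

Lemma sum_near (n i : nat) : \sum_(k < n) ~~ far i k <= 3.
Proof.
have le1 j : \sum_(k < n) (k == j :> nat) <= 1.
  case: (ltnP j n) => jn.
    rewrite (bigD1 (Ordinal jn))//= eqxx big1// => k kj.
    by rewrite (_ : (k == j :> nat) = (k == Ordinal jn))// (negbTE kj).
  by rewrite big1// => k _; rewrite (ltn_eqF (leq_trans (ltn_ord k) jn)).
(* For [i = 0] the index [i.-1] coincides with [i] and is counted twice, which an upper bound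
   tolerates. *)
apply: (@leq_trans (\sum_(k < n) ((k == i.-1 :> nat) + (k == i :> nat) + (k == i.+1 :> nat)))).
  apply: leq_sum => k _; rewrite farE; move: (nat_of_ord k) => m.
  by case: (m =P i.-1); case: (m =P i); case: (m =P i.+1); lia.
by rewrite !big_split/= -[3]/(1 + 1 + 1) !leq_add.
Qed.

Definition near_pair (n : nat) (s t : 'I_n * 'I_n) : bool :=
  (~~ far s.1 t.1 && ~~ far s.2 t.2) || (~~ far s.1 t.2 && ~~ far s.2 t.1).

Lemma far_sym i j : far i j = far j i.
Proof. by rewrite !farE orbC. Qed.

Lemma near_pair_sym n : symmetric (@near_pair n).
Proof.
move=> s t; rewrite /near_pair.
by rewrite !(far_sym t.1) !(far_sym t.2) (andbC (~~ far s.2 t.1)).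
Qed.

(** The constant is [2 * 3 * 3]: two ways of matching the pairs, and at most three indices near a
    given one. *)
Lemma sum_near_pair n (s : 'I_n * 'I_n) : \sum_t near_pair s t <= 18.
Proof.
apply: (@leq_trans (\sum_(t : 'I_n * 'I_n) ((~~ far s.1 t.1) * (~~ far s.2 t.2)
                     + (~~ far s.2 t.1) * (~~ far s.1 t.2)))).
  apply: leq_sum => t _; rewrite /near_pair.
  by case: (far s.1 t.1); case: (far s.2 t.2); case: (far s.1 t.2); case: (far s.2 t.1).
have h (i j : nat) : \sum_(t : 'I_n * 'I_n) (~~ far i t.1) * (~~ far j t.2) <= 9.
  rewrite -(pair_bigA _ (fun k l : 'I_n => (~~ far i k) * (~~ far j l)))/=.
  under eq_bigr do rewrite -big_distrr/=.
  by rewrite -big_distrl/= -[9]/(3 * 3) leq_mul// sum_near.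
by rewrite big_split/= -[18]/(9 + 9) leq_add// h.
Qed.

End near.

(** * Variances of the linear and of the quadratic form *)

Section quadratic_statistic.
Context d (T : measurableType d) (R : realType) (P : probability T R).
Variable X : nat -> T -> R.
Hypothesis mX : forall i, measurable_fun setT (X i).
Hypothesis iX : mutually_independent P X.
Hypothesis idX : identically_distributed P X.
Hypothesis X1 : (\int[P]_w (X 0%N w)%:E = 0)%E.
Hypothesis X2 : (\int[P]_w ((X 0%N w) ^+ 2)%:E = 1)%E.
Hypothesis X4 : (\int[P]_w ((X 0%N w) ^+ 4)%:E < +oo)%E.
Variables (n : nat) (U : seq (nat * nat)) (c : nat -> nat * nat -> R) (b : R).
Hypothesis U0 : forall u, u \in U -> (0 < u.1 + u.2)%N.
Hypothesis cb : forall i u, `|c i u| <= b.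

Let tens := @tensor _ _ X n.+1.
Let B := phi_bound P X.

(** The centred square [Z_i], for an abstract finite support [U] and coefficients [c]; the
    increments are plugged in later by [inc_support] and [inc_coef]. The tensors have [n.+1] sites
    because the noise variables [0, ..., n] all occur. *)
Definition Zsum (i : nat) (w : T) : R := \sum_(u <- U) c i u * tens (pat i u) w.

Definition Zsum_bound2 : R := (size U)%:R ^+ 2 * (b ^+ 2 * B ^+ 2).
Definition Zsum_bound4 : R := (size U)%:R ^+ 4 * (b ^+ 4 * B ^+ 4).

Let b0 : 0 <= b.
Proof. exact: le_trans (normr_ge0 (c 0 (0, 0)%N)) (cb _ _). Qed.

Let B0 : 0 <= B.
Proof. exact: le_trans ler01 (phi_bound_ge1 _ _). Qed.

Lemma Zsum_bound2_ge0 : 0 <= Zsum_bound2.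
Proof. by rewrite !mulr_ge0// ?exprn_ge0. Qed.

Lemma Zsum_bound4_ge0 : 0 <= Zsum_bound4.
Proof. by rewrite !mulr_ge0// ?exprn_ge0. Qed.

Let iT e e' : P.-integrable setT (fun w => (tens e w * tens e' w)%:E).
Proof. exact: integrable_tensorM. Qed.

Lemma integrable_Zsum2 i k :
  P.-integrable setT (fun w => (Zsum i w * Zsum k w)%:E).
Proof. exact: integrable_mul_lin. Qed.

Lemma pat_neq0 i u : u \in U -> exists m, [/\ (m = i \/ m = i.+1) & (0 < pat i u m)%N].
Proof.
move=> uU; have := U0 uU; case: (posnP u.1) => [->|u1 _].
  rewrite add0n => u2; exists i.+1; split; first by right.
  by rewrite /pat eqxx -[X in X == i]addn1 -[X in _ == X]addn0 eqn_add2l.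
by exists i; split; [left|rewrite /pat eqxx].
Qed.

Lemma pat_far0 i k u m : far i k -> m = i \/ m = i.+1 -> pat k u m = 0%N.
Proof.
rewrite farE /pat => h hm; case: eqP => [|_]; first lia.
by case: eqP => //; lia.
Qed.

(** Far indices: every pattern of [U] at [i] is positive at [i] or [i.+1], where all patterns at [k]
    vanish, so each term of the expansion is zero. Near indices: the [(size U)^2] terms are bounded
    one by one. *)
Lemma Rintegral_Zsum2 (i k : 'I_n) :
  `|\int[P]_w (Zsum i w * Zsum k w)| <= Zsum_bound2 * (~~ far i k)%:R.
Proof.
have iN m : (m < n -> m.+1 < n.+1)%N by [].
rewrite /Zsum Rintegral_mul_lin//.
have [fik|nf] := boolP (far i k).
  rewrite mulr0 big1_seq ?normr0// => p /allpairsP[q [q1 q2 ->]]/=.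
  have [m [mi um]] := pat_neq0 i q1.
  rewrite (tensor_orth mX iX idX X1 X2 X4 (m := m)) ?mulr0//.
    by case: mi => ->; have := ltn_ord i; lia.
  exact: pat_far0 fik mi.
rewrite mulr1 /Zsum_bound2 expr2 -natrM -(size_allpairs (fun u v => (u, v)) U U).
apply: norm_sum_seq_le => p _; rewrite !normrM expr2.
apply: ler_pM => //; first exact: ler_pM.
by apply: tensor_norm_le => //; apply: tensor_pat_le => //; rewrite ltnS.
Qed.

Lemma ZsumM (i j : 'I_n) w : far i j ->
  Zsum i w * Zsum j w = \sum_(p <- [seq (u, v) | u <- U, v <- U])
     (c i p.1 * c j p.2) * tens (pat2 i p.1 j p.2) w.
Proof.
move=> fij; rewrite /Zsum mul_lin; apply: eq_bigr => p _; congr (_ * _).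
by rewrite /tens tensor_pat2// ltnS.
Qed.

(** Zero on near pairs, where [acoef] vanishes too. So the quadratic form becomes a sum over all
    pairs, and [ZsumM] covers each pair that is not set to zero. *)
Definition Zpair (s : 'I_n * 'I_n) (w : T) : R :=
  if far s.1 s.2 then Zsum s.1 w * Zsum s.2 w else 0.

Lemma ZpairE (s : 'I_n * 'I_n) w : far s.1 s.2 ->
  Zpair s w = \sum_(p <- [seq (u, v) | u <- U, v <- U])
     (c s.1 p.1 * c s.2 p.2) * tens (pat2 s.1 p.1 s.2 p.2) w.
Proof. by move=> h; rewrite /Zpair h ZsumM. Qed.

Lemma integrable_Zpair (s t : 'I_n * 'I_n) :
  P.-integrable setT (fun w => (Zpair s w * Zpair t w)%:E).
Proof.
have [fs|nfs] := boolP (far s.1 s.2); last first.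
  rewrite /Zpair (negbTE nfs); under eq_fun do rewrite mul0r.
  exact: integrable0.
have [ft|nft] := boolP (far t.1 t.2); last first.
  rewrite /Zpair (negbTE nft); under eq_fun do rewrite mulr0.
  exact: integrable0.
under eq_fun do rewrite !ZpairE//.
exact: (integrable_mul_lin _ _ _ _ (fun p q => iT (pat2 s.1 p.1 s.2 p.2) (pat2 t.1 q.1 t.2 q.2))).
Qed.

(** An index of [s] that is far from both indices of [t] provides a site where the pattern of [s] is
    positive and the pattern of [t] is zero. *)
Lemma Zpair_orth (s t : 'I_n * 'I_n) (i : 'I_n) : i = s.1 \/ i = s.2 -> far i t.1 -> far i t.2 ->
  \int[P]_w (Zpair s w * Zpair t w) = 0.
Proof.
move=> his f1 f2.
have [fs|nfs] := boolP (far s.1 s.2); last first.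
  rewrite /Zpair (negbTE nfs); under eq_Rintegral do rewrite mul0r.
  by rewrite Rintegral_cst_prob.
have [ft|nft] := boolP (far t.1 t.2); last first.
  rewrite /Zpair (negbTE nft); under eq_Rintegral do rewrite mulr0.
  by rewrite Rintegral_cst_prob.
under eq_Rintegral do rewrite !ZpairE//.
rewrite (Rintegral_mul_lin _ _
  (fun p => c s.1 p.1 * c s.2 p.2) (fun q => c t.1 q.1 * c t.2 q.2)
  (fun p q => iT (pat2 s.1 p.1 s.2 p.2) (pat2 t.1 q.1 t.2 q.2))).
rewrite big1_seq// => p /allpairsP[[p1 p2] [/= /allpairsP[[u v] [/= uU vU ->]] _ ->]]/=.
have [m [mi um]] : exists m, [/\ m = (i : nat) \/ m = i.+1 & (0 < pat2 s.1 u s.2 v m)%N].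
  case: his => his.
  - have [m [mi um]] := pat_neq0 s.1 uU; exists m; rewrite his; split => //.
    by rewrite /pat2 ltn_addr.
  - have [m [mi um]] := pat_neq0 s.2 vU; exists m; rewrite his; split => //.
    by rewrite /pat2 ltn_addl.
rewrite (tensor_orth mX iX idX X1 X2 X4 (m := m)) ?mulr0//.
  by case: mi => ->; have := ltn_ord i; lia.
by rewrite /pat2 !(pat_far0 _ _ mi).
Qed.

(** If both matchings fail, each of them has a far couple; these two couples share one of the four
    indices, and that index is far from both members of the opposite pair, so [Zpair_orth] applies
    to it. *)
Lemma Rintegral_Zpair (s t : 'I_n * 'I_n) :
  `|\int[P]_w (Zpair s w * Zpair t w)| <= Zsum_bound4 * (near_pair s t)%:R.
Proof.
have [fs|nfs] := boolP (far s.1 s.2); last first.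
  rewrite /Zpair (negbTE nfs); under eq_Rintegral do rewrite mul0r.
  by rewrite Rintegral_cst_prob normr0 mulr_ge0// Zsum_bound4_ge0.
have [ft|nft] := boolP (far t.1 t.2); last first.
  rewrite /Zpair (negbTE nft); under eq_Rintegral do rewrite mulr0.
  by rewrite Rintegral_cst_prob normr0 mulr_ge0// Zsum_bound4_ge0.
have [np|] := boolP (near_pair s t); last first.
  move=> np; rewrite mulr0 normr_le0; apply/eqP.
  have : [|| far s.1 t.1 && far s.1 t.2, far s.2 t.1 && far s.2 t.2,
             far t.1 s.1 && far t.1 s.2 | far t.2 s.1 && far t.2 s.2].
    move: np; rewrite /near_pair !(far_sym t.1) !(far_sym t.2).
    by case: (far s.1 t.1); case: (far s.1 t.2); case: (far s.2 t.1); case: (far s.2 t.2).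
  case/or4P => /andP[f1 f2].
  - by apply: Zpair_orth f1 f2; left.
  - by apply: Zpair_orth f1 f2; right.
  - by under eq_Rintegral do rewrite mulrC; apply: Zpair_orth f1 f2; left.
  - by under eq_Rintegral do rewrite mulrC; apply: Zpair_orth f1 f2; right.
rewrite mulr1; under eq_Rintegral do rewrite !ZpairE//.
rewrite (Rintegral_mul_lin _ _
  (fun p => c s.1 p.1 * c s.2 p.2) (fun q => c t.1 q.1 * c t.2 q.2)
  (fun p q => iT (pat2 s.1 p.1 s.2 p.2) (pat2 t.1 q.1 t.2 q.2))).
have sz : (size U)%:R ^+ 4 = (size [seq (p, q) | p <- [seq (u, v) | u <- U, v <- U],
      q <- [seq (u, v) | u <- U, v <- U]])%:R :> R.
  by rewrite !size_allpairs !natrM; ring.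
rewrite /Zsum_bound4 sz.
apply: norm_sum_seq_le => p _; rewrite !normrM.
rewrite (_ : b ^+ 4 = (b * b) * (b * b)); last by ring.
apply: ler_pM => //.
  by apply: ler_pM => //; apply: ler_pM.
by apply: tensor_norm_le => //; apply: tensor_pat2_le => //; rewrite ltnS.
Qed.

Lemma linear_part_le (a : 'I_n -> R) :
  \int[P]_w ((\sum_i a i * Zsum i w) ^+ 2) <= Zsum_bound2 * 3%:R * \sum_i a i ^+ 2.
Proof.
apply: (quad_form_le (r := fun i k : 'I_n => ~~ far i k)).
- by move=> i k; exact: integrable_Zsum2.
- exact: Rintegral_Zsum2.
- exact: Zsum_bound2_ge0.
- by move=> i k; rewrite far_sym.
- by move=> i; exact: sum_near.
Qed.

Lemma quadratic_part_le (a : 'I_n * 'I_n -> R) :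
  \int[P]_w ((\sum_s a s * Zpair s w) ^+ 2) <= Zsum_bound4 * 18%:R * \sum_s a s ^+ 2.
Proof.
apply: (quad_form_le (r := @near_pair n)).
- exact: integrable_Zpair.
- exact: Rintegral_Zpair.
- exact: Zsum_bound4_ge0.
- exact: near_pair_sym.
- exact: sum_near_pair.
Qed.

End quadratic_statistic.

(** * Bias and sums of squared coefficients *)

Section deterministic.
Variables (R : realType) (n : nat) (kap : 'I_n -> 'I_n -> R) (m : 'I_n -> R).
Variables (Kb S Bm eta : R).
Hypothesis n0 : (0 < n)%N.
Hypothesis kap_sym : forall i j, kap i j = kap j i.
Hypothesis kap0 : forall i j, 0 <= kap i j.
Hypothesis kap_near : forall i j : 'I_n, ~~ far i j -> kap i j = 0.
Hypothesis kapKb : forall i j, kap i j <= Kb.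
Local Notation rho i := (\sum_j kap i j).
Hypothesis rho1 : forall i, rho i <= 1.
Hypothesis rhoS : \sum_i (1 - rho i) <= S.
Hypothesis mB : forall i, `|m i| <= Bm.
Hypothesis m_eta : forall i j, kap i j != 0 -> `|m i - m j| <= eta.

Local Notation N := (n%:R : R).
Local Notation mbar := (N^-1 * \sum_i m i).
Definition nearR (i j : 'I_n) : R := (~~ far i j)%:R.
Local Notation nu := nearR.
Definition acoef (i j : 'I_n) : R := if far i j then N^-1 * kap i j - (N ^+ 2)^-1 else 0.

Let N0 : N != 0.
Proof. by rewrite pnatr_eq0 -lt0n. Qed.

Let Ngt0 : 0 < N.
Proof. by rewrite ltr0n. Qed.

(** Trades the case distinction for a correction by [nu], so that the main sums run over all pairs
    and the square of [\sum_i m i] can be recognised. *)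
Let acoefE i j : acoef i j = N^-1 * kap i j - (N ^+ 2)^-1 + (N ^+ 2)^-1 * nu i j.
Proof.
rewrite /acoef /nearR; case: ifPn => fij /=; first by rewrite mulr0 addr0.
by rewrite kap_near// mulr1 mulr0 sub0r addNr.
Qed.

Let sumnu (i : 'I_n) : \sum_j nu i j <= 3.
Proof.
have := sum_near n i.
by rewrite -(ler_nat R) natr_sum.
Qed.

Let nu0 (i j : 'I_n) : 0 <= nu i j. Proof. exact: ler0n. Qed.

Let m2B i : m i ^+ 2 <= Bm ^+ 2.
Proof.
rewrite -real_normK ?num_real// lerXn2r ?nnegrE ?normr_ge0//.
exact: le_trans (normr_ge0 _) (mB i).
Qed.

Let sum1 : \sum_(i < n) (1 : R) = N.
Proof. by rewrite sumr_const card_ord. Qed.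

Lemma expand_centered (Z : 'I_n -> R) (a : 'I_n -> 'I_n -> R) :
  (forall i j, a i j = a j i) ->
  \sum_i \sum_j a i j * ((m i + Z i) * (m j + Z j)) =
  \sum_i \sum_j a i j * (m i * m j) + 2 * (\sum_i (\sum_j a i j * m j) * Z i)
  + \sum_i \sum_j a i j * (Z i * Z j).
Proof.
move=> asym.
have e1 : \sum_i \sum_j a i j * (Z i * m j) = \sum_i (\sum_j a i j * m j) * Z i.
  by apply: eq_bigr => i _; rewrite mulr_suml; apply: eq_bigr => j _; ring.
have e2 : \sum_i \sum_j a i j * (m i * Z j) = \sum_i (\sum_j a i j * m j) * Z i.
  rewrite exchange_big/= -e1; apply: eq_bigr => i _; apply: eq_bigr => j _.
  by rewrite asym (mulrC (m j)).
rewrite mulr2n mulrDl mul1r -{1}e1 -e2 -!big_split/=; apply: eq_bigr => i _.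
by rewrite -!big_split/=; apply: eq_bigr => j _; ring.
Qed.

Local Notation Tst := (N^-1 * \sum_i (m i - mbar) ^+ 2).

Let TstE : Tst = N^-1 * \sum_i m i ^+ 2 - mbar ^+ 2.
Proof.
have -> : \sum_i (m i - mbar) ^+ 2 = \sum_i m i ^+ 2 - 2 * mbar * \sum_i m i + N * mbar ^+ 2.
  move: mbar => b; rewrite -sum1 mulr_suml mulr_sumr -sumrN -!big_split/=.
  by apply: eq_bigr => i _; ring.
have -> : \sum_i m i = N * mbar by rewrite mulrA divff// mul1r.
by field.
Qed.

(** By [2 a b = a^2 + b^2 - (a - b)^2] and symmetry, the weighted sum of [m i * m j] is
    [\sum_i m i ^+ 2 - A - Q / 2], with [A] the boundary defect and [Q] the smoothing error. The
    terms in [mbar ^+ 2] cancel against [Tst], leaving [A], [Q] and the near-diagonal sum [L]. *)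
Lemma bias_le :
  `|\sum_i \sum_j acoef i j * (m i * m j) - Tst| <=
  Bm ^+ 2 * S / N + eta ^+ 2 / 2 + 3 * Bm ^+ 2 / N.
Proof.
pose A := \sum_i m i ^+ 2 * (1 - rho i).
pose Q := \sum_i \sum_j kap i j * (m i - m j) ^+ 2.
pose L := \sum_i \sum_j nu i j * (m i * m j).
have hk : \sum_i \sum_j kap i j * (m i * m j) = \sum_i m i ^+ 2 - A - Q / 2.
  have q1 : \sum_i \sum_j kap i j * m i ^+ 2 = \sum_i m i ^+ 2 * rho i.
    by apply: eq_bigr => i _; rewrite -mulr_suml mulrC.
  have q2 : \sum_i \sum_j kap i j * m j ^+ 2 = \sum_i m i ^+ 2 * rho i.
    rewrite exchange_big/= -q1; apply: eq_bigr => i _; apply: eq_bigr => j _.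
    by rewrite kap_sym.
  have -> : \sum_i m i ^+ 2 - A = \sum_i m i ^+ 2 * rho i.
    by rewrite /A -sumrN -big_split/=; apply: eq_bigr => i _; ring.
  have -> : Q = 2 * (\sum_i m i ^+ 2 * rho i) - 2 * \sum_i \sum_j kap i j * (m i * m j).
    rewrite mulr2n mulrDl mul1r -{1}q1 -q2 mulr_sumr -sumrN -!big_split/=.
    apply: eq_bigr => i _; rewrite mulr_sumr -sumrN -!big_split/=.
    by apply: eq_bigr => j _; ring.
  by field.
have -> : \sum_i \sum_j acoef i j * (m i * m j) - Tst =
    N^-1 * (- A - Q / 2) + (N ^+ 2)^-1 * L.
  have -> : \sum_i \sum_j acoef i j * (m i * m j) =
    N^-1 * (\sum_i \sum_j kap i j * (m i * m j)) - (N ^+ 2)^-1 * (\sum_i m i) ^+ 2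
    + (N ^+ 2)^-1 * L.
    rewrite [(\sum_i m i) ^+ 2]expr2 mulr_suml !mulr_sumr -sumrN -!big_split/=; apply: eq_bigr => i _.
    rewrite !mulr_sumr -sumrN -!big_split/=; apply: eq_bigr => j _.
    by rewrite acoefE; ring.
  rewrite hk TstE.
  have -> : \sum_i m i = N * mbar by rewrite mulrA divff// mul1r.
  by field.
have A0 : 0 <= A by apply: sumr_ge0 => i _; rewrite mulr_ge0 ?sqr_ge0// subr_ge0.
have AS : A <= Bm ^+ 2 * S.
  apply: (@le_trans _ _ (Bm ^+ 2 * \sum_i (1 - rho i))); last by rewrite ler_wpM2l// sqr_ge0.
  by rewrite mulr_sumr; apply: ler_sum => i _; rewrite ler_wpM2r// subr_ge0.
have Q0 : 0 <= Q.
  by apply: sumr_ge0 => i _; apply: sumr_ge0 => j _; rewrite mulr_ge0 ?sqr_ge0.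
have Qe : Q <= eta ^+ 2 * N.
  rewrite -sum1 mulr_sumr; apply: ler_sum => i _; rewrite mulr1.
  apply: (@le_trans _ _ (\sum_j kap i j * eta ^+ 2)).
    apply: ler_sum => j _; have [->|k0] := eqVneq (kap i j) 0; first by rewrite !mul0r.
    rewrite ler_wpM2l// -real_normK ?num_real// lerXn2r ?nnegrE ?normr_ge0 ?m_eta//.
    exact: le_trans (normr_ge0 _) (m_eta k0).
  by rewrite -mulr_suml ler_piMl// sqr_ge0.
have LB : `|L| <= 3 * Bm ^+ 2 * N.
  rewrite -sum1 mulr_sumr; apply: le_trans (ler_norm_sum _ _ _) _.
  apply: ler_sum => i _; rewrite mulr1; apply: le_trans (ler_norm_sum _ _ _) _.
  apply: (@le_trans _ _ (\sum_j nu i j * Bm ^+ 2)).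
    apply: ler_sum => j _; rewrite normrM ger0_norm// ler_wpM2l//.
    by rewrite normrM expr2 ler_pM.
  by rewrite -mulr_suml ler_wpM2r// sqr_ge0.
apply: le_trans (ler_normD _ _) _.
rewrite !normrM !(@ger0_norm _ _^-1) ?invr_ge0 ?exprn_ge0 ?(ltW Ngt0)//.
have -> : Bm ^+ 2 * S / N + eta ^+ 2 / 2 + 3 * Bm ^+ 2 / N =
   N^-1 * (Bm ^+ 2 * S + eta ^+ 2 * N / 2) + (N ^+ 2)^-1 * (3 * Bm ^+ 2 * N) by field.
apply: lerD; apply: ler_wpM2l => //; rewrite ?invr_ge0 ?exprn_ge0 ?(ltW Ngt0)//.
rewrite -opprD normrN ger0_norm ?lerD ?ler_pM2r//.
by rewrite addr_ge0// divr_ge0.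
Qed.

Local Notation brow i := (\sum_j acoef i j * m j).

(** As the rows of [kap] sum to almost one, [brow i] is [1 / N] times a weighted average [s i] of
    the centred means, up to the row defect and a near-diagonal term. The factor 3 comes from
    squaring three summands, the 9 from [(3 Bm)^2]. *)
Lemma linear_coef_le :
  \sum_i brow i ^+ 2 <=
  3 / N ^+ 2 * (\sum_i (m i - mbar) ^+ 2 + Bm ^+ 2 * S + 9 * Bm ^+ 2 / N).
Proof.
pose s i := \sum_j kap i j * (m j - mbar).
pose l i := \sum_j nu i j * m j.
have bE i : brow i = N^-1 * (s i - mbar * (1 - rho i) + N^-1 * l i).
  have -> : s i = \sum_j kap i j * m j - mbar * rho i.
    rewrite /s; move: mbar => b; rewrite mulr_sumr -sumrN -big_split/=.
    by apply: eq_bigr => j _; ring.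
  have -> : brow i = N^-1 * (\sum_j kap i j * m j) - (N ^+ 2)^-1 * (\sum_j m j)
      + (N ^+ 2)^-1 * l i.
    rewrite !mulr_sumr -sumrN -!big_split/=; apply: eq_bigr => j _.
    by rewrite acoefE; ring.
  have -> : \sum_i m i = N * mbar by rewrite mulrA divff// mul1r.
  by field.
have mbB : mbar ^+ 2 <= Bm ^+ 2.
  have -> : Bm ^+ 2 = (N^-1 * (Bm * N)) ^+ 2 by field.
  have BN : `|\sum_i m i| <= Bm * N.
    rewrite -sum1 mulr_sumr; apply: le_trans (ler_norm_sum _ _ _) _.
    by apply: ler_sum => i _; rewrite mulr1.
  rewrite -real_normK ?num_real// lerXn2r ?nnegrE ?normr_ge0//.
    by rewrite mulr_ge0 ?invr_ge0 ?(ltW Ngt0)// (le_trans (normr_ge0 _) BN).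
  by rewrite normrM ger0_norm ?invr_ge0 ?(ltW Ngt0)// ler_wpM2l// invr_ge0 ltW.
(* Jensen's inequality for weights of total mass at most one: expand the nonnegative sum of
   [kap i j * (m j - mbar - s i) ^+ 2]. *)
have s2 i : s i ^+ 2 <= \sum_j kap i j * (m j - mbar) ^+ 2.
  have : 0 <= \sum_j kap i j * (m j - mbar - s i) ^+ 2.
    by apply: sumr_ge0 => j _; rewrite mulr_ge0 ?sqr_ge0.
  have -> : \sum_j kap i j * (m j - mbar - s i) ^+ 2 =
      \sum_j kap i j * (m j - mbar) ^+ 2 - 2 * s i * s i + s i ^+ 2 * rho i.
    have : s i = \sum_j kap i j * (m j - mbar) by [].
    move: (s i) mbar => x b xE.
    have -> : 2 * x * x = 2 * x * \sum_j kap i j * (m j - b) by rewrite -xE.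
    rewrite !mulr_sumr -sumrN -!big_split/=; apply: eq_bigr => j _; ring.
  have : s i ^+ 2 * rho i <= s i ^+ 2 by rewrite ler_piMr ?sqr_ge0.
  move: (\sum_j _) => t; lra.
have sumcol : \sum_i \sum_j kap i j * (m j - mbar) ^+ 2 <= \sum_i (m i - mbar) ^+ 2.
  rewrite exchange_big/=; apply: ler_sum => j _; rewrite -mulr_suml.
  rewrite ler_piMl ?sqr_ge0//; under eq_bigr do rewrite kap_sym; exact: rho1.
have l2 i : l i ^+ 2 <= 9 * Bm ^+ 2.
  have -> : 9 * Bm ^+ 2 = (3 * Bm) ^+ 2 by ring.
  have lB : `|l i| <= 3 * Bm.
    apply: le_trans (ler_norm_sum _ _ _) _.
    apply: (@le_trans _ _ (\sum_j nu i j * Bm)).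
      by apply: ler_sum => j _; rewrite normrM ger0_norm// ler_wpM2l.
    by rewrite -mulr_suml ler_wpM2r// (le_trans (normr_ge0 _) (mB i)).
  by rewrite -real_normK ?num_real// lerXn2r ?nnegrE ?normr_ge0// (le_trans (normr_ge0 _) lB).
have rho0 i : 0 <= rho i by apply: sumr_ge0.
have main i : brow i ^+ 2 <= 3 / N ^+ 2 *
    (\sum_j kap i j * (m j - mbar) ^+ 2 + Bm ^+ 2 * (1 - rho i) + N^-1 ^+ 2 * (9 * Bm ^+ 2)).
  rewrite bE exprMn [leLHS](_ : _ = 3 / N ^+ 2 *
    ((s i - mbar * (1 - rho i) + N^-1 * l i) ^+ 2 / 3)); last by field.
  rewrite ler_wpM2l ?divr_ge0 ?exprn_ge0 ?(ltW Ngt0)//.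
  (* Since [0 <= 1 - rho i <= 1], the squared defect is at most the defect, whose total is [S]. *)
  have h1 : (mbar * (1 - rho i)) ^+ 2 <= Bm ^+ 2 * (1 - rho i).
    rewrite exprMn ler_pM ?sqr_ge0//.
    rewrite expr2 ler_piMr ?subr_ge0//; have := rho0 i; lra.
  have h2 : (N^-1 * l i) ^+ 2 <= N^-1 ^+ 2 * (9 * Bm ^+ 2).
    by rewrite exprMn ler_wpM2l ?sqr_ge0.
  have h3 := s2 i.
  move: (s i) (mbar * (1 - rho i)) (N^-1 * l i) h1 h2 h3 => x y z h1 h2 h3.
  have : (x - y + z) ^+ 2 <= 3 * (x ^+ 2 + y ^+ 2 + z ^+ 2).
    have := sqr_ge0 (x + y); have := sqr_ge0 (x - z); have := sqr_ge0 (y + z); nra.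
  lra.
apply: le_trans (ler_sum _ (fun i _ => main i)) _.
rewrite -mulr_sumr ler_wpM2l ?divr_ge0 ?exprn_ge0 ?(ltW Ngt0)//.
rewrite !big_split/= lerD ?lerD//.
  by rewrite -mulr_sumr ler_wpM2l// sqr_ge0.
have -> : \sum_(i < n) (N^-1 ^+ 2 * (9 * Bm ^+ 2)) = N * (N^-1 ^+ 2 * (9 * Bm ^+ 2)).
  by rewrite sumr_const card_ord [RHS]mulr_natl.
by rewrite [leLHS](_ : _ = 9 * Bm ^+ 2 / N)//; field.
Qed.

(** Only one factor of [kap i j ^+ 2] is bounded by [Kb]; the other is summed by [rho1]. This gives
    [Kb * N] over all pairs where bounding both would give [Kb ^+ 2 * N ^+ 2]. *)
Lemma quad_coef_le :
  \sum_(s : 'I_n * 'I_n) acoef s.1 s.2 ^+ 2 <= 2 * Kb / N + 2 / N ^+ 2.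
Proof.
have aij i j : acoef i j ^+ 2 <= 2 / N ^+ 2 * Kb * kap i j + 2 * (N ^+ 2)^-1 ^+ 2.
  have e0 : 0 <= 2 / N ^+ 2 * Kb * kap i j + 2 * (N ^+ 2)^-1 ^+ 2.
    have Kb0 := le_trans (kap0 i j) (kapKb i j).
    by rewrite addr_ge0// !mulr_ge0// ?invr_ge0 ?exprn_ge0 ?(ltW Ngt0)// invr_ge0 exprn_ge0// ltW.
  rewrite /acoef; case: ifPn => _; last by rewrite expr0n.
  have h : (N^-1 * kap i j) ^+ 2 <= (N ^+ 2)^-1 * Kb * kap i j.
    rewrite exprMn exprVn -mulrA ler_wpM2l ?invr_ge0 ?exprn_ge0 ?(ltW Ngt0)//.
    by rewrite expr2 ler_wpM2r.
  move: h; rewrite [2 / N ^+ 2 * Kb * kap i j](_ : _ = 2 * ((N ^+ 2)^-1 * Kb * kap i j)); last by ring.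
  move: (N^-1 * kap i j) ((N ^+ 2)^-1 * Kb * kap i j) ((N ^+ 2)^-1) => x y z.
  by have := sqr_ge0 (x + z); nra.
rewrite -(pair_bigA _ (fun i j => acoef i j ^+ 2))/=.
apply: (@le_trans _ _ (\sum_(i < n) (2 / N ^+ 2 * Kb + 2 * (N ^+ 2)^-1 ^+ 2 * N))).
  apply: ler_sum => i _; apply: le_trans (ler_sum _ (fun j _ => aij i j)) _.
  rewrite big_split/= lerD//.
    have Kb0 := le_trans (kap0 i i) (kapKb i i).
    rewrite -mulr_sumr ler_piMr ?rho1// mulr_ge0// divr_ge0// exprn_ge0// ltW//.
  by rewrite sumr_const card_ord [leRHS]mulr_natr.
rewrite sumr_const card_ord -[leLHS]mulr_natr.
by rewrite [leLHS](_ : _ = 2 * Kb / N + 2 / N ^+ 2)//; field.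
Qed.

End deterministic.

(** * Kernel weights *)

Section change_of_variables.
Variable R : realType.
Local Notation mu := (@lebesgue_measure R).

(** By uniqueness of Lebesgue measure: the pushforward multiplied by [r^-1] has the right value on
    half-open intervals. *)
Lemma lebesgue_measure_scale (r : R) (A : set R) : 0 < r -> measurable A ->
  pushforward mu (fun x : measurableTypeR R => x / r : measurableTypeR R) A = (r%:E * mu A)%E.
Proof.
move=> r0 mA.
have mf : measurable_fun setT (fun x : measurableTypeR R => x / r : measurableTypeR R).
  exact: (measurable_funM (@measurable_id _ _ _) (@measurable_cst _ _ _ _ _ _)).
have ri0 : 0 <= r^-1 by rewrite invr_ge0 ltW.
pose nu0 := mscale (NngNum ri0)
  (pushforward mu (fun x : measurableTypeR R => x / r : measurableTypeR R)).
pose nu : {measure set (measurableTypeR R) -> \bar R} := nu0 mf.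
have nuE B : nu B = (r^-1%:E *
  pushforward mu (fun x : measurableTypeR R => (x / r)%R : measurableTypeR R) B)%E by [].
have h : forall B, measurable B -> mu B = nu B.
  apply: lebesgue_measure_unique => _ [[a b]] _ <-.
  rewrite nuE /pushforward (_ : _ @^-1` _ = `]a * r, b * r]%classic); last first.
    by apply/seteqP; split => x /=; rewrite !in_itv/= ltr_pdivlMr// ler_pdivrMr.
  rewrite !lebesgue_measure_itv/= !lte_fin ltr_pM2r//.
  case: ifPn => _; last by rewrite mule0.
  by rewrite -!EFinD -EFinM; congr _%:E; field; rewrite gt_eqF.
by rewrite h// nuE muleA -EFinM divff ?gt_eqF// mul1e.
Qed.

Lemma ge0_integral_scale (r : R) (g : R -> R) (D : set R) : 0 < r ->
  measurable D -> measurable_fun setT g -> (forall x, 0 <= g x) ->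
  (\int[mu]_(x in (fun x : R => (x / r)%R) @^-1` D) (g (x / r))%:E =
   r%:E * \int[mu]_(x in D) (g x)%:E)%E.
Proof.
move=> r0 mD mg g0.
have mf : measurable_fun setT (fun x : measurableTypeR R => x / r : measurableTypeR R).
  exact: (measurable_funM (@measurable_id _ _ _) (@measurable_cst _ _ _ _ _ _)).
have mgE : measurable_fun D (fun x => (g x)%:E).
  by apply/measurable_EFinP; exact: measurable_funTS.
have := @ge0_integral_pushforward _ _ _ _ _ _ mf mu D (fun x => (g x)%:E) mD mgE (fun x _ => g0 x).
move=> /= <-.
have -> : r = (NngNum (ltW r0))%:num by [].
rewrite -ge0_integral_mscale//; last by move=> x _; rewrite lee_fin.
by apply: eq_measure_integral => A mA _; exact: lebesgue_measure_scale.
Qed.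

Lemma ge0_integral_opp (g : R -> R) (D : set R) :
  measurable D -> measurable_fun setT g -> (forall x, 0 <= g x) ->
  (\int[mu]_(x in (@GRing.opp R) @^-1` D) (g (- x))%:E =
   \int[mu]_(x in D) (g x)%:E)%E.
Proof.
move=> mD mg g0.
have mf : measurable_fun setT (-%R : measurableTypeR R -> measurableTypeR R).
  exact: oppr_measurable.
have mgE : measurable_fun D (fun x => (g x)%:E).
  by apply/measurable_EFinP; exact: measurable_funTS.
have := @ge0_integral_pushforward _ _ _ _ _ _ mf mu D (fun x => (g x)%:E) mD mgE (fun x _ => g0 x).
move=> /= <-.
by apply: eq_measure_integral => A mA _; exact: lebesgue_measureN.
Qed.

End change_of_variables.

Section intab_facts.
Variable R : realType.
Local Notation mu := (@lebesgue_measure R).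

Lemma intabE (a b : R) g : intab a b g = \int[mu]_(x in `[a, b]) g x.
Proof. by rewrite /intab set_itvcc. Qed.

Lemma lebesgue_itvcc_fin (a b : R) : (mu `[a, b] < +oo)%E.
Proof. by rewrite lebesgue_measure_itv/=; case: ifPn; rewrite ?ltry// -EFinD ltry. Qed.

Lemma integrable_cst_itvcc (a b q : R) : mu.-integrable `[a, b] (EFin \o (fun=> q)).
Proof.
apply: (@measurable_bounded_integrable _ _ _ mu (fun=> q)) => //.
- exact: lebesgue_itvcc_fin.
- by exists `|q|; split => [|N qN x _ /=]; [exact: num_real|exact: ltW].
Qed.

Lemma Rintegral_cst_itvcc (a b q : R) : a <= b ->
  \int[mu]_(x in `[a, b]) q = q * (b - a).
Proof.
move=> ab; rewrite Rintegral_cst//; have -> // : fine (mu `[a, b]) = b - a.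
rewrite lebesgue_measure_itv/= lte_fin.
case: ifPn => [//|]; rewrite -leNgt => ba.
by have -> : a = b by [apply: le_anti; rewrite ab ba]; rewrite subrr.
Qed.

Section bounded_integrand.
Variables (g : R -> R) (B : R).
Hypothesis mg : measurable_fun setT g.
Hypothesis g0 : forall x, 0 <= g x.
Hypothesis gB : forall x, g x <= B.

Lemma bounded_integrable_itv (i : interval R) a b : [set` i] `<=` `[a, b]%classic ->
  mu.-integrable [set` i] (EFin \o g).
Proof.
move=> iab; apply: measurable_bounded_integrable => //.
- by apply: le_lt_trans (lebesgue_itvcc_fin a b); apply: le_measure => //; rewrite inE.
- exact: measurable_funTS.
- exists B; split; first exact: num_real.
  by move=> M BM x _ /=; rewrite ger0_norm// (le_trans (gB x))// ltW.
Qed.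

Lemma intab_add a b c : a <= b -> b <= c -> intab a c g = intab a b g + intab b c g.
Proof.
move=> ab bc; rewrite !intabE -(@Rintegral_itv_obnd_cbnd _ b (BRight c)).
  rewrite -(@Rintegral_itvB _ g (BLeft a) (BRight c) b)//.
  - by ring.
  - exact: (bounded_integrable_itv (a := a) (b := c)).
apply: (bounded_integrable_itv (a := b) (b := c)) => x /=; rewrite !in_itv/=.
by case/andP => /ltW -> ->.
Qed.

Lemma intab_ge0 a b : 0 <= intab a b g.
Proof. by rewrite intabE; exact: Rintegral_ge0. Qed.

Lemma intab_le a b : a <= b -> intab a b g <= B * (b - a).
Proof.
move=> ab; rewrite intabE.
rewrite -Rintegral_cst_itvcc//.
apply: le_Rintegral => //; first exact: (bounded_integrable_itv (a := a) (b := b)).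
exact: integrable_cst_itvcc.
Qed.

End bounded_integrand.
End intab_facts.

Section kernel.
Variables (R : realType) (K : R -> R) (c : R).
Local Notation mu := (@lebesgue_measure R).
Hypothesis mK : measurable_fun setT K.
Hypothesis Kout : forall x, 1 < `|x| -> K x = 0.
Hypothesis Ksym : forall x, K (- x) = K x.
Hypothesis c0 : 0 < c.
Hypothesis Kc : forall x, -1 <= x <= 1 -> c <= K x <= c^-1.
Hypothesis K1 : intab (-1) 1 K = 1.
Variables (n : nat) (h : R).
Hypothesis n0 : (0 < n)%N.
Hypothesis nh : 8 / c <= n%:R * h.

Local Notation Kh := (fun u : R => h^-1 * K (u / h)).
Local Notation N := (n%:R : R).

Let N0 : 0 < N. Proof. by rewrite ltr0n. Qed.

Let h0 : 0 < h.
Proof.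
rewrite -(pmulr_rgt0 _ N0); apply: lt_le_trans nh.
by rewrite divr_gt0.
Qed.

Let K_ge0 x : 0 <= K x.
Proof.
have [x1|x1] := ltP 1 `|x|; first by rewrite Kout.
by move: x1; rewrite ler_norml => /Kc/andP[+ _]; apply: le_trans; exact: ltW.
Qed.

Let K_le x : K x <= c^-1.
Proof.
have [x1|x1] := ltP 1 `|x|; first by rewrite Kout// invr_ge0 ltW.
by move: x1; rewrite ler_norml => /Kc/andP[].
Qed.

Let c1 : c <= 1.
Proof.
have /Kc/andP[ck kc] : -1 <= (0 : R) <= 1 by rewrite lerN10 ler01.
have := le_trans ck kc; rewrite -[leRHS]mul1r ler_pdivlMr// -expr2 expr_le1//.
exact: ltW.
Qed.

Let mKh : measurable_fun setT Kh.
Proof.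
apply: measurable_funM; first exact: measurable_cst.
apply: (measurableT_comp mK).
exact: (measurable_funM (@measurable_id _ _ _) (@measurable_cst _ _ _ _ _ _)).
Qed.

Let Kh_ge0 x : 0 <= Kh x.
Proof. by rewrite mulr_ge0// invr_ge0 ltW. Qed.

Let Kh_le x : Kh x <= (c * h)^-1.
Proof. by rewrite invfM mulrC ler_wpM2r// invr_ge0 ltW. Qed.

Local Notation F x := (intab 0 x Kh).

Let Kh_total : intab (- h) h Kh = 1.
Proof.
rewrite -K1 /intab /Rintegral; congr fine.
under eq_integral do rewrite EFinM.
rewrite ge0_integralZl//; last 4 first.
- by have := measurable_itv `[- h, h]; rewrite set_itvcc.
- apply/measurable_EFinP; apply: measurable_funTS; apply: (measurableT_comp mK).
  exact: (measurable_funM (@measurable_id _ _ _) (@measurable_cst _ _ _ _ _ _)).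
- by move=> x _; rewrite lee_fin.
- by rewrite lee_fin invr_ge0 ltW.
have -> : [set x | - h <= x <= h] = (fun x : R => x / h) @^-1` [set x | -1 <= x <= 1].
  by apply/seteqP; split => x /=; rewrite ler_pdivlMr// ler_pdivrMr// mulN1r mul1r.
rewrite ge0_integral_scale//; last first.
  by have := measurable_itv `[-1 : R, 1]; rewrite set_itvcc.
by rewrite muleA -EFinM mulVf ?gt_eqF// mul1e.
Qed.

Let Kh_sym x : intab (- x) 0 Kh = F x.
Proof.
rewrite /intab /Rintegral; congr fine.
have mD : measurable [set y : R | 0 <= y <= x].
  by have := measurable_itv `[0 : R, x]; rewrite set_itvcc.
rewrite -(ge0_integral_opp mD mKh Kh_ge0).
have -> : (@GRing.opp R) @^-1` [set y | 0 <= y <= x] = [set y | - x <= y <= 0].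
  by apply/seteqP; split => y /=; rewrite oppr_ge0 lerNl andbC.
by apply: eq_integral => y _; rewrite mulNr Ksym.
Qed.

Let Kh_dbl x : 0 <= x -> intab (- x) x Kh = 2 * F x.
Proof.
move=> x0; rewrite (intab_add mKh Kh_ge0 Kh_le (b := 0)) ?oppr_le0// Kh_sym.
by ring.
Qed.

(** Half of the unit mass lies on [[0, h]] by symmetry, and [Kh] vanishes beyond [h]. *)
Let F_half x : h <= x -> F x = 2^-1.
Proof.
move=> hx.
have Fh : F h = 2^-1.
  by have := Kh_dbl (ltW h0); rewrite Kh_total; move: (F h) => t; lra.
rewrite (intab_add mKh Kh_ge0 Kh_le (ltW h0) hx) Fh.
have -> : intab h x Kh = 0; last by rewrite addr0.
(* The left endpoint is dropped because the kernel is positive at 1. *)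
rewrite intabE -Rintegral_itv_obnd_cbnd; last first.
  apply: (bounded_integrable_itv mKh Kh_ge0 Kh_le (a := h) (b := x)) => y /=.
  by rewrite !in_itv/= => /andP[/ltW -> ->].
rewrite (@eq_Rintegral _ _ _ _ _ (fun=> 0)).
  by rewrite Rintegral_cst// mul0r.
move=> y; rewrite inE/= in_itv/= => /andP[hy _].
by rewrite Kout ?mulr0// ger0_norm ?divr_ge0 ?(ltW h0) ?ltr_pdivlMr ?mul1r// ltW// (lt_trans h0).
Qed.

Let F_incr x y : 0 <= x -> x <= y -> intab x y Kh = F y - F x.
Proof. by move=> x0 xy; rewrite (intab_add mKh Kh_ge0 Kh_le x0 xy); ring. Qed.

(** This is where [8 / c] is spent: [Kh <= 1 / (c h)] gives at most [2 / (c N h) <= 1 / 4], so the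
    denominator [den] of the weights is at least one half. *)
Let F2 : F (2 / N) <= 4^-1.
Proof.
apply: le_trans (intab_le mKh Kh_ge0 Kh_le _) _; first by rewrite divr_ge0// ltW.
rewrite subr0 mulrC -mulrA -invfM ler_pdivrMr ?mulr_gt0//.
have := nh; rewrite ler_pdivrMr//.
have -> : N * (c * h) = N * h * c by ring.
lra.
Qed.

Definition kap (d : nat) : R := Knh K n h d%:Z.

Lemma Knh_kap (t : int) : Knh K n h t = kap (absz t).
Proof. by rewrite /kap /Knh absz_nat. Qed.

Let den := 1 - 2 * F (2 / N).
Let den_ge : 2^-1 <= den.
Proof. by have := F2; rewrite /den; lra. Qed.

Let den_gt0 : 0 < den.
Proof. by apply: lt_le_trans den_ge. Qed.

Let kapE d : (2 <= d)%N -> kap d = (F (d.+1%:R / N) - F (d%:R / N)) / den.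
Proof.
move=> d2; rewrite /kap /Knh absz_nat d2 Kh_dbl ?divr_ge0 ?(ltW N0)// (F_incr (x := d%:R / N))//.
by rewrite ler_pM2r ?invr_gt0// ler_nat.
Qed.

Lemma kap_lt2 d : (d < 2)%N -> kap d = 0.
Proof. by move=> d2; rewrite /kap /Knh absz_nat leqNgt d2. Qed.

Lemma kap_ge0 d : 0 <= kap d.
Proof.
have [d2|d2] := leqP 2 d; last by rewrite kap_lt2.
rewrite kapE// -F_incr; last 2 first.
- by rewrite divr_ge0// ltW.
- by rewrite ler_pM2r ?invr_gt0// ler_nat.
by rewrite divr_ge0 ?intab_ge0// ltW.
Qed.

(** A cell has length [1 / N], [Kh] is at most [1 / (c h)], and the 2 comes from [den >= 1 / 2]. *)
Lemma kap_le d : kap d <= 2 / c / (N * h).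
Proof.
have C0 : 0 <= 2 / c / (N * h) by rewrite !divr_ge0 ?mulr_ge0// ltW.
have [d2|d2] := leqP 2 d; last by rewrite kap_lt2.
have dd : d%:R / N <= d.+1%:R / N by rewrite ler_pM2r ?invr_gt0// ler_nat.
rewrite kapE// -F_incr//.
rewrite ler_pdivrMr//.
apply: le_trans (intab_le mKh Kh_ge0 Kh_le dd) _.
apply: (@le_trans _ _ (2 / c / (N * h) * 2^-1)); last by rewrite ler_wpM2l.
rewrite -natr1 [leLHS](_ : _ = 2 / c / (N * h) / 2)//; field.
by rewrite !gt_eqF.
Qed.

Lemma kap_support d : N * h <= d%:R -> kap d = 0.
Proof.
move=> hd; have [d2|d2] := leqP 2 d; last by rewrite kap_lt2.
have h1 : h <= d%:R / N by rewrite ler_pdivlMr// mulrC.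
rewrite kapE// !F_half// ?subrr ?mul0r//.
by apply: (le_trans h1); rewrite ler_pM2r ?invr_gt0// ler_nat.
Qed.

(** The cells telescope, starting at [2 / N] since lags 0 and 1 carry no weight. Beyond the
    bandwidth the numerator is [1 / 2 - F (2 / N)], exactly half of [den]: the normalisation
    restores the mass of the omitted lags. *)
Let kapS m : (2 <= m)%N -> \sum_(d < m) kap d = (F (m%:R / N) - F (2 / N)) / den.
Proof.
elim: m => [//|m IH]; rewrite leq_eqVlt => /predU1P[[<-]|].
  by rewrite !big_ord_recr big_ord0/= !kap_lt2// subrr mul0r !addr0.
rewrite ltnS => m2; rewrite big_ord_recr/= IH// kapE// -mulrDl.
by congr (_ / _); ring.
Qed.

Lemma sum_kap_le m : \sum_(d < m) kap d <= 2^-1.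
Proof.
have [m2|m2] := leqP 2 m; last first.
  by rewrite big1// => d _; rewrite kap_lt2// (leq_trans (ltn_ord d))// ltnW.
rewrite kapS// ler_pdivrMr//.
suff : F (m%:R / N) <= 2^-1 by rewrite /den; lra.
have [hm|mh] := leP h (m%:R / N); first by rewrite F_half.
have m0 : 0 <= m%:R / N by rewrite divr_ge0// ltW.
rewrite -(F_half (lexx h)) -subr_ge0 -F_incr ?intab_ge0//.
exact: ltW.
Qed.

Lemma sum_kap_eq m : N * h <= m%:R -> \sum_(d < m) kap d = 2^-1.
Proof.
move=> hm; have h1 : h <= m%:R / N by rewrite ler_pdivlMr// mulrC.
have m2 : (2 <= m)%N.
  rewrite -(ler_nat R); apply: le_trans hm; apply: le_trans nh.
  rewrite ler_pdivlMr//; have := c1; lra.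
rewrite kapS// F_half//; apply: (mulIf (lt0r_neq0 den_gt0)).
by rewrite divfK ?lt0r_neq0// /den; move: (F (2 / N)) => t; field.
Qed.

End kernel.

(** * Row sums of a distance kernel on a finite grid *)

Section row_sums.
Variables (R : realType) (k : nat -> R).
Hypothesis k0 : k 0%N = 0.

(** The row is cut after the diagonal: lags [0, ..., i] on the left, [1, ..., n - i - 1] on the
    right. Lag 0 is added to the right-hand sum for symmetry, which [k0] allows. *)
Lemma sum_absz_row (n i : nat) : (i < n)%N ->
  \sum_(j < n) k `|i%:Z - j%:Z|%N = \sum_(d < i.+1) k d + \sum_(d < n - i) k d.
Proof.
move=> lt_in.
rewrite -(big_mkord xpredT (fun j => k `|i%:Z - j%:Z|%N)) (@big_cat_nat _ _ _ i.+1)//=.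
congr (_ + _).
  rewrite big_mkord (reindex_inj rev_ord_inj)/=; apply: eq_bigr => j _.
  by congr k; have := ltn_ord j; lia.
rewrite -{1}[i.+1]add0n big_addn.
have -> : (n - i = (n - i.+1).+1)%N by lia.
rewrite big_ord_recl k0 add0r big_mkord; apply: eq_bigr => j _.
by congr k; rewrite [RHS](_ : _ = j.+1)//; lia.
Qed.

Lemma count_lt_le (n : nat) (x : R) : 0 <= x ->
  \sum_(j < n) (j.+1%:R < x)%R%:R <= x :> R.
Proof.
move=> x0; elim: n => [|n IH]; first by rewrite big_ord0.
rewrite big_ord_recr/=; have [h|h] := ltP n.+1%:R x; last by rewrite addr0.
apply: le_trans (ltW h); rewrite -natr1 lerD//.
rewrite -[leRHS]mulr1 mulr_natl -[X in _ *+ X]card_ord -sumr_const.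
by apply: ler_sum => j _; case: (_ < x).
Qed.

Variable x : R.
Hypothesis kge0 : forall d, 0 <= k d.
Hypothesis k_half : forall m, \sum_(d < m) k d <= 2^-1.
Hypothesis k_full : forall m, x <= m%:R -> \sum_(d < m) k d = 2^-1.
Hypothesis x0 : 0 <= x.

Lemma row_sum_le1 (n : nat) (i : 'I_n) : \sum_(j < n) k `|i%:Z - j%:Z|%N <= 1.
Proof.
rewrite sum_absz_row//.
by have := k_half i.+1; have := k_half (n - i); lra.
Qed.

(** The defect of row [i] is [t i.+1 + t (n - i)], and reversing the indices shows that both parts
    have the same total. Each [2 * t m] is at most 1 and vanishes for [m >= x], so counting finishes
    the proof; [x] will be [n h]. *)
Lemma row_defect_le (n : nat) :
  \sum_(i < n) (1 - \sum_(j < n) k `|i%:Z - j%:Z|%N) <= x.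
Proof.
pose t m := 2^-1 - \sum_(d < m) k d.
have -> : \sum_(i < n) (1 - \sum_(j < n) k `|i%:Z - j%:Z|%N) =
          2 * \sum_(i < n) t i.+1.
  have e : \sum_(i < n) t (n - i)%N = \sum_(i < n) t i.+1.
    rewrite (reindex_inj rev_ord_inj)/=; apply: eq_bigr => i _.
    by congr t; have := ltn_ord i; lia.
  rewrite mulr2n mulrDl mul1r -{2}e -big_split/=; apply: eq_bigr => i _.
  by rewrite sum_absz_row// /t; lra.
have t_le i : 2 * t i.+1 <= (i.+1%:R < x)%R%:R.
  rewrite /t; have [h|h] := ltP i.+1%:R x; last by rewrite k_full// subrr mulr0.
  have : 0 <= \sum_(d < i.+1) k d by exact: sumr_ge0.
  by rewrite /=; lra.
rewrite mulr_sumr; apply: le_trans (count_lt_le n x0).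
by apply: ler_sum => i _; exact: t_le.
Qed.

End row_sums.

Section riemann.
Variable R : realType.
Local Notation mu := (@lebesgue_measure R).
Variables (g : R -> R) (B : R).
Hypothesis mg : measurable_fun setT g.
Hypothesis g0 : forall x, 0 <= g x.
Hypothesis gB : forall x, g x <= B.

Lemma intab_ge (a b q : R) : a <= b -> (forall x, a <= x <= b -> q <= g x) ->
  q * (b - a) <= intab a b g.
Proof.
move=> ab qg; rewrite intabE.
rewrite -Rintegral_cst_itvcc//; apply: le_Rintegral => //.
  exact: integrable_cst_itvcc.
exact: (bounded_integrable_itv mg g0 gB (a := a) (b := b)).
Qed.

Lemma intab_sum (n : nat) : (0 < n)%N ->
  intab 0 1 g = \sum_(j < n) intab (j%:R / n%:R) (j.+1%:R / n%:R) g.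
Proof.
move=> n0; have N0 : 0 < n%:R :> R by rewrite ltr0n.
have h m : intab 0 (m%:R / n%:R) g = \sum_(j < m) intab (j%:R / n%:R) (j.+1%:R / n%:R) g.
  elim: m => [|m IH].
    rewrite big_ord0 mul0r; apply: le_anti.
    by rewrite intab_ge0// andbT (le_trans (intab_le mg g0 gB (lexx 0)))// subrr mulr0.
  rewrite big_ord_recr/= -IH; apply: (intab_add mg g0 gB); first by rewrite divr_ge0.
  by rewrite ler_pM2r ?invr_gt0// ler_nat.
by rewrite -h divff ?gt_eqF.
Qed.

End riemann.

(** * Holder functions on the grid *)

Section holder_facts.
Variable R : realType.
Implicit Types (f g V : R -> R) (M x y : R).

Lemma deriv01_dist g g' x : deriv01 g g' -> 0 <= x <= 1 ->
  forall e : R, 0 < e -> exists2 dl : R, 0 < dl &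
    forall y, 0 <= y <= 1 -> y != x -> `|x - y| < dl ->
      `|g' x - (g y - g x) / (y - x)| < e.
Proof.
move=> gg' x01 e e0; have /cvgrPdist_lt/(_ e e0) := gg' x x01.
rewrite /prop_near1 /within/= => /nbhs_ballP[dl /= dl0 H].
by exists dl => // y y01 yx xy; apply: H.
Qed.

Lemma deriv01_is_derive g g' x : deriv01 g g' -> 0 < x < 1 ->
  is_derive x 1 g (g' x).
Proof.
move=> gg' /andP[x0 x1].
have x01 : 0 <= x <= 1 by rewrite !ltW.
have H : h^-1 *: ((g \o shift x) (h *: 1) - g x) @[h --> 0^'] --> g' x.
  apply/cvgrPdist_lt => e e0; have [dl dl0 Hdl] := deriv01_dist gg' x01 e0.
  have m0 : 0 < Num.min dl (Num.min x (1 - x)) by rewrite !lt_min dl0 x0 subr_gt0.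
  apply/nbhs_ballP; exists (Num.min dl (Num.min x (1 - x))) => //= h.
  rewrite /ball/= sub0r normrN !lt_min => /and3P[h1 h2 h3] h0.
  have -> : h^-1 *: (g (h *: 1 + x) - g x) = (g (h + x) - g x) / (h + x - x).
    by rewrite addrK [h *: 1]mulr1 mulrC.
  move: h2 h3 => /ltr_normlP[h2 h2'] /ltr_normlP[h3 h3'].
  have := Hdl (h + x); apply.
  - by apply/andP; split; lra.
  - by rewrite -subr_eq0 addrK.
  - by rewrite opprD addrCA subrr addr0 normrN.
have D : derivable g x 1 by apply/cvg_ex; exists (g' x).
by apply: DeriveDef => //; exact/cvg_lim.
Qed.

(** Derivatives are one-sided at 0 and 1, so continuity is read off the difference quotients, which
    near [x] are bounded by [L], that is [|g' x| + 1]. *)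
Lemma deriv01_continuous g g' : deriv01 g g' -> {within `[0, 1], continuous g}.
Proof.
move=> gg'; apply/continuous_within_itvP; first exact: ltr01.
have dist x : 0 <= x <= 1 -> forall e, 0 < e -> exists2 dl : R, 0 < dl &
    forall y, 0 <= y <= 1 -> `|x - y| < dl -> `|g x - g y| < e.
  move=> x01 e e0; have [dl dl0 H] := deriv01_dist gg' x01 ltr01.
  pose L := `|g' x| + 1; have L0 : 0 < L by rewrite ltr_wpDl.
  exists (Num.min dl (e / L)); first by rewrite lt_min dl0 divr_gt0.
  move=> y y01; rewrite lt_min => /andP[h1 h2].
  have [->|yx] := eqVneq y x; first by rewrite subrr normr0.
  have := H y y01 yx h1; set q := (g y - g x) / (y - x) => hq.
  have qL : `|q| < L.
    by rewrite /L -[q](subrK (g' x)) (le_lt_trans (ler_normD _ _))// addrC ltrD2l distrC.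
  have -> : g x - g y = q * (x - y).
    by rewrite /q -[x - y]opprB mulrN divfK ?subr_eq0// opprB.
  rewrite normrM; move: h2; rewrite ltr_pdivlMr// => h2.
  have xy0 : 0 < `|x - y| by rewrite normr_gt0 subr_eq0 eq_sym.
  by apply: lt_trans h2; rewrite mulrC ltr_pM2l.
split.
- move=> x; rewrite in_itv/= => /andP[x0 x1].
  have [] := deriv01_is_derive gg' (x := x); first by rewrite x0.
  by move=> D _; apply: differentiable_continuous; apply/derivable1_diffP.
- apply/cvgrPdist_lt => e e0; have z01 : 0 <= (0 : R) <= 1 by rewrite lexx ler01.
  have [dl dl0 H] := dist 0 z01 e e0.
  apply/nbhs_ballP; exists (Num.min dl 1); first by rewrite /= lt_min dl0 ltr01.
  move=> y; rewrite /ball/= lt_min => /andP[h1 h2] y0; apply: H => //.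
  by move: h2; rewrite ltW//= sub0r normrN gtr0_norm// => /ltW.
- apply/cvgrPdist_lt => e e0; have z01 : 0 <= (1 : R) <= 1 by rewrite lexx ler01.
  have [dl dl0 H] := dist 1 z01 e e0.
  apply/nbhs_ballP; exists (Num.min dl 1); first by rewrite /= lt_min dl0 ltr01.
  move=> y; rewrite /ball/= lt_min => /andP[h1 h2] y1; apply: H => //.
  rewrite (ltW y1) andbT; move: h2; rewrite gtr0_norm ?subr_gt0// => h2; lra.
Qed.

Lemma deriv01_lipschitz g g' M x y : deriv01 g g' ->
  (forall x, 0 <= x <= 1 -> `|g' x| <= M) ->
  0 <= x <= 1 -> 0 <= y <= 1 -> `|g x - g y| <= M * `|x - y|.
Proof.
move=> gg' g'M; wlog xy : x y / x < y => [H x01 y01|x01 y01].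
  have [xy|yx|->] := ltgtP x y; [exact: H| |by rewrite !subrr normr0 mulr0].
  by rewrite distrC (distrC x); exact: H.
have [x0 x1] := andP x01; have [y0 y1] := andP y01.
have [||z zxy gz] := @MVT R g g' x y xy.
- move=> z; rewrite in_itv/= => /andP[xz zy]; apply: deriv01_is_derive => //.
  by rewrite (le_lt_trans x0 xz) (lt_le_trans zy y1).
- apply: continuous_subspaceW (deriv01_continuous gg') => t /=.
  by rewrite !in_itv/= => /andP[xt ty]; rewrite (le_trans x0 xt) (le_trans ty y1).
rewrite distrC gz normrM (distrC x) ler_wpM2r//; apply: g'M.
move: zxy; rewrite in_itv/= => /andP[xz zy].
by rewrite (le_trans x0 (ltW xz)) (le_trans (ltW zy) y1).
Qed.

Lemma holder_bound a M f x : holder a M f -> 0 <= x <= 1 -> `|f x| <= M.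
Proof. by move=> [gs [<- _ h _]]; apply: h. Qed.

Lemma holder_lt1 a M f x y : 0 < a -> a < 1 -> holder a M f ->
  0 <= x <= 1 -> 0 <= y <= 1 -> `|f x - f y| <= M * `|x - y| `^ a.
Proof.
move=> a0 a1 [gs [<- _ _ h]] x01 y01.
have t0 : Num.truncn a = 0%N by apply/truncn0Pn; rewrite -ltNge.
by have := h x y x01 y01; rewrite t0 subr0.
Qed.

(** For [a >= 1] the bounded first derivative gives a Lipschitz estimate, which is all that first
    differences can use; [rate_delta] shows that this costs nothing. *)
Lemma holder_min1 a M f x y : 0 < a -> 0 <= M -> holder a M f ->
  0 <= x <= 1 -> 0 <= y <= 1 -> `|f x - f y| <= M * `|x - y| `^ Num.min a 1.
Proof.
move=> a0 M0 hf x01 y01; have [a1|a1] := ltP a 1; first exact: holder_lt1.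
rewrite powRr1//; have [gs [<- dg bg _]] := hf.
have m0 : (0 < Num.truncn a)%N by rewrite truncn_gt0.
by apply: (deriv01_lipschitz (g' := gs 1%N)) => //; [exact: dg|exact: bg].
Qed.

Lemma holder_measurable a M f : 0 < a -> a < 1 -> 0 < M -> holder a M f ->
  measurable_fun (`[0, 1]%classic : set R) f.
Proof.
move=> a0 a1 M0 hf; apply: subspace_continuous_measurable_fun => //.
have dist x : 0 <= x <= 1 -> forall e, 0 < e -> exists2 dl : R, 0 < dl &
    forall y, 0 <= y <= 1 -> `|x - y| < dl -> `|f x - f y| < e.
  move=> x01 e e0; exists ((e / M) `^ a^-1); first by apply: powR_gt0; exact: divr_gt0.
  move=> y y01 xy; apply: le_lt_trans (holder_lt1 a0 a1 hf x01 y01) _.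
  rewrite mulrC -ltr_pdivlMr//.
  have -> : e / M = ((e / M) `^ a^-1) `^ a.
    by rewrite -powRrM mulVf ?gt_eqF// powRr1// divr_ge0 ?ltW.
  by apply: gt0_ltr_powR => //; rewrite nnegrE ?powR_ge0.
apply/subspace_continuousP => x /=; rewrite in_itv/= => x01.
apply/cvgrPdist_lt => e e0; have [dl dl0 H] := dist x x01 e e0.
rewrite /prop_near1 /within/=; apply/nbhs_ballP; exists dl => //= y xy.
by rewrite in_itv/= => y01; exact: H.
Qed.

End holder_facts.

(** * Riemann sums of squared deviations *)

Section riemann_holder.
Variables (R : realType) (b M v : R) (V : R -> R).
Hypothesis b0 : 0 < b.
Hypothesis b1 : b < 1.
Hypothesis M0 : 0 < M.
Hypothesis hV : holder b M V.

(** On each cell [(V (p j) - v)^2 / 2] is at most [(V x - v)^2] plus the squared oscillation; this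
    is integrated over the cell. The point [p j] is left free because both endpoints are needed for
    [Wi]. *)
Lemma riemann_holder (n : nat) (p : nat -> R) : (0 < n)%N ->
  (forall j, (j < n)%N -> j%:R / n%:R <= p j <= j.+1%:R / n%:R) ->
  n%:R^-1 * \sum_(j < n) (V (p j) - v) ^+ 2 <=
  2 * intab 0 1 (fun x => (V x - v) ^+ 2) + 2 * (M * n%:R^-1 `^ b) ^+ 2.
Proof.
move=> n0 hp; have N0 : 0 < n%:R :> R by rewrite ltr0n.
pose D : set R := `[0, 1]%classic.
(* Nothing is known about [V] outside the unit interval, so the integrand is cut off there to be
   measurable and bounded on the line. *)
pose g := (fun x => (V x - v) ^+ 2) \_ D.
have inD x : 0 <= x <= 1 -> x \in D by move=> h; rewrite inE /D/= in_itv.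
have gE x : 0 <= x <= 1 -> g x = (V x - v) ^+ 2 by move=> /inD h; rewrite /g patchE h.
have mg : measurable_fun setT g.
  apply: (measurable_restrictT _ (measurable_itv _)).1.
  apply: measurable_funX; apply: measurable_funB; last exact: measurable_cst.
  exact: (holder_measurable b0 b1 M0 hV).
have g0 x : 0 <= g x by rewrite /g patchE; case: ifP => // _; exact: sqr_ge0.
have gB x : g x <= (M + `|v|) ^+ 2.
  rewrite /g patchE; case: ifPn => [|_]; last exact: sqr_ge0.
  rewrite inE /D/= in_itv/= => x01.
  rewrite -real_normK ?num_real// lerXn2r ?nnegrE ?normr_ge0 ?addr_ge0 ?(ltW M0)//.
  by rewrite (le_trans (ler_normB _ _))// lerD2r (holder_bound hV).
have -> : intab 0 1 (fun x => (V x - v) ^+ 2) = intab 0 1 g.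
  by rewrite /intab; apply: eq_Rintegral => x; rewrite inE/= => x01; exact/esym/gE.
rewrite (intab_sum mg g0 gB n0).
have -> : 2 * (M * n%:R^-1 `^ b) ^+ 2 =
    \sum_(j < n) 2 * ((M * n%:R^-1 `^ b) ^+ 2 / n%:R).
  by rewrite sumr_const card_ord -[RHS]mulr_natr; field; rewrite gt_eqF.
rewrite !mulr_sumr -big_split/=; apply: ler_sum => j _.
have jn := ltn_ord j; have /andP[p1 p2] := hp j jn.
have a0 : 0 <= j%:R / n%:R :> R by rewrite divr_ge0.
have a1 : j.+1%:R / n%:R <= 1 :> R by rewrite ler_pdivrMr// mul1r ler_nat.
have len : j.+1%:R / n%:R - j%:R / n%:R = n%:R^-1 :> R.
  by rewrite -natr1; field; rewrite gt_eqF.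
have := @intab_ge R g _ mg g0 gB (j%:R / n%:R) (j.+1%:R / n%:R)
  ((V (p j) - v) ^+ 2 / 2 - (M * n%:R^-1 `^ b) ^+ 2).
rewrite len => H; have /H {}H : j%:R / n%:R <= j.+1%:R / n%:R :> R by exact: le_trans p2.
suff /H : forall x, j%:R / n%:R <= x <= j.+1%:R / n%:R ->
    (V (p j) - v) ^+ 2 / 2 - (M * n%:R^-1 `^ b) ^+ 2 <= g x.
  set s := intab _ _ _; set t := (V (p j) - v) ^+ 2.
  set u := (M * n%:R^-1 `^ b) ^+ 2; set w := (n%:R^-1 : R); nra.
move=> x /andP[x1 x2].
have x01 : 0 <= x <= 1 by rewrite (le_trans a0 x1) (le_trans x2 a1).
have p01 : 0 <= p j <= 1 by rewrite (le_trans a0 p1) (le_trans p2 a1).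
rewrite gE//.
have h1 : `|V (p j) - V x| <= M * n%:R^-1 `^ b.
  apply: le_trans (holder_lt1 b0 b1 hV p01 x01) _; rewrite ler_pM2l//.
  apply: ge0_ler_powR; rewrite ?nnegrE ?normr_ge0 ?invr_ge0 ?(ltW N0) ?(ltW b0)//.
  by rewrite ler_norml; apply/andP; split; lra.
have h2 : (V (p j) - V x) ^+ 2 <= (M * n%:R^-1 `^ b) ^+ 2.
  by rewrite -real_normK ?num_real// lerXn2r ?nnegrE ?normr_ge0// (le_trans (normr_ge0 _) h1).
have := sqr_ge0 ((V (p j) - V x) - (V x - v)).
move: h2; move: (V (p j)) (V x) ((M * _) ^+ 2) => s t u; nra.
Qed.

End riemann_holder.

(** * Powers of [n] compared with the target rate *)

Section rates.
Variables (R : realType) (al be Ch : R) (n : nat).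
Hypothesis be0 : 0 < be.
Hypothesis be1 : be < 2^-1.
Hypothesis Ch0 : 0 < Ch.
Hypothesis n0 : (0 < n)%N.
Local Notation p := (n%:R : R).
Local Notation g := (Num.min (2 / (4 * be + 1)) 1).
Local Notation h := (Ch * p `^ (- g)).
Local Notation r2 := (p `^ (- (4 * be))).
Local Notation r3 := (p `^ (- (8 * be / (4 * be + 1)))).

Let p1 : 1 <= p. Proof. by rewrite ler1n. Qed.
Let p0 : 0 < p. Proof. by rewrite ltr0n. Qed.
Let q0 : 0 < 4 * be + 1. Proof. by (move: be0 be1; rewrite /=; lra). Qed.

Let mono (a b : R) : b <= a -> p `^ (- a) <= p `^ (- b).
Proof. by move=> ab; rewrite ler_powR// lerN2. Qed.

Let powX (a : R) k : (p `^ (- a)) ^+ k = p `^ (- (a * k%:R)).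
Proof. by rewrite -powR_mulrn ?powR_ge0// -powRrM mulNr. Qed.

Lemma natr_invX k : p^-1 ^+ k = p `^ (- k%:R).
Proof. by rewrite powRN powR_mulrn ?(ltW p0)// exprVn. Qed.

Lemma natr_inv_powR a : p^-1 `^ a = p `^ (- a).
Proof. by rewrite -(powR_inv1 (ltW p0)) -powRrM mulN1r. Qed.

Let r2_ge0 : 0 <= r2. Proof. exact: powR_ge0. Qed.
Let r3_ge0 : 0 <= r3. Proof. exact: powR_ge0. Qed.

Lemma rate_inv2 : p^-1 ^+ 2 <= r2.
Proof. by rewrite natr_invX mono//; (move: be0 be1; rewrite /=; lra). Qed.

(** The cap is active only for [be <= 1/4]; there [r2] absorbs the estimates below, otherwise [r3]
    does. *)
Let g_cases (P : R -> Prop) :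
  (be <= 4^-1 -> P 1) -> P (2 / (4 * be + 1)) -> P g.
Proof.
move=> h1 h2; have [h3|h3] := ltP (2 / (4 * be + 1)) 1; first exact: h2.
by apply: h1; move: h3; rewrite ler_pdivlMr//; (move: be0 be1; rewrite /=; lra).
Qed.

Lemma rate_h2 : h ^+ 2 <= Ch ^+ 2 * (r2 + r3).
Proof.
rewrite exprMn ler_wpM2l ?sqr_ge0// powX.
apply: (g_cases (P := fun t => p `^ (- (t * 2)) <= r2 + r3)) => [b4|].
  by apply: (@le_trans _ _ r2); [apply: mono; (move: be0 be1; rewrite /=; lra)|rewrite lerDl].
apply: (@le_trans _ _ r3); last by rewrite lerDr.
apply: mono; rewrite ler_pdivrMr//.
have -> : 2 / (4 * be + 1) * 2 * (4 * be + 1) = 4 by field; rewrite gt_eqF.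
(move: be0 be1; rewrite /=; lra).
Qed.

(** No loss in either case: the exponent is [4 be] with the cap and [8 be / (4 be + 1)] without. *)
Lemma rate_h4 : (h `^ be) ^+ 4 <= (Ch `^ be) ^+ 4 * (r2 + r3).
Proof.
rewrite powRM ?powR_ge0 ?(ltW Ch0)// exprMn ler_wpM2l ?exprn_ge0 ?powR_ge0//.
rewrite -powRrM mulNr powX.
apply: (g_cases (P := fun t => p `^ (- (t * be * 4)) <= r2 + r3)) => [b4|].
  by apply: (@le_trans _ _ r2); [apply: mono; (move: be0 be1; rewrite /=; lra)|rewrite lerDl].
apply: (@le_trans _ _ r3); last by rewrite lerDr.
apply: mono; rewrite [leRHS](_ : _ = 8 * be / (4 * be + 1))//; field.
by rewrite gt_eqF.
Qed.

(** Without the cap the exponent [2 - 2 / (4 be + 1)] equals [8 be / (4 be + 1)], the balance that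
    fixes the bandwidth. With it, [n^(-1) <= n^(-4 be)] because [be <= 1/4]. *)
Lemma rate_nh : p^-1 / (p * h) <= Ch^-1 * (r2 + r3).
Proof.
have -> : p^-1 / (p * h) = Ch^-1 * (p `^ (- (2 - g))).
  rewrite opprB powRB; last by apply/implyP => _; rewrite gt_eqF.
  rewrite powR_mulrn ?(ltW p0)// powRN; field.
  by rewrite !gt_eqF// powR_gt0.
rewrite ler_wpM2l ?invr_ge0 ?(ltW Ch0)//.
apply: (g_cases (P := fun t => p `^ (- (2 - t)) <= r2 + r3)) => [b4|].
  by apply: (@le_trans _ _ r2); [apply: mono; (move: be0 be1; rewrite /=; lra)|rewrite lerDl].
apply: (@le_trans _ _ r3); last by rewrite lerDr.
apply: mono; rewrite [leRHS](_ : _ = 8 * be / (4 * be + 1))//; field.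
by rewrite gt_eqF.
Qed.

Lemma rate_delta M : (M ^+ 2 * (p^-1 `^ Num.min al 1) ^+ 2) ^+ 4 <=
  M ^+ 8 * (p `^ (- (8 * al)) + r2).
Proof.
have M8 : 0 <= M ^+ 8 by rewrite -[8%N]/(4 * 2)%N exprM sqr_ge0.
rewrite exprMn -!exprM ler_wpM2l//.
rewrite natr_inv_powR powX -[(2 * 4)%N]/8%N; have [a1|a1] := ltP al 1.
  by rewrite (mulrC al) lerDl.
apply: (@le_trans _ _ r2); last by rewrite lerDr powR_ge0.
by apply: mono; (move: be0 be1; rewrite /=; lra).
Qed.

Lemma rate_omega : p^-1 * (p^-1 `^ be) ^+ 2 <= r2.
Proof.
rewrite natr_inv_powR powX -[X in X * _]expr1 natr_invX -powRD; last first.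
  by apply/implyP => _; rewrite gt_eqF.
by rewrite -opprD mono//=; (move: be0 be1; rewrite /=; lra).
Qed.

Lemma rate_nh_ge : Ch <= p * h.
Proof.
rewrite mulrCA ler_peMr ?(ltW Ch0)//.
rewrite -[X in X * _](powRr1 (ltW p0)) -powRD; last by apply/implyP => _; rewrite gt_eqF.
rewrite -[leLHS](powRr0 p) ler_powR// subr_ge0.
by rewrite ge_min lexx orbT.
Qed.

End rates.

(** * Mean squared error *)

Section increments.
Context d (T : measurableType d).
Variables (R : realType) (X : nat -> T -> R) (n : nat).
Variables (s dl : nat -> R).

(** The noise monomials in the square of [dl i + s i.+1 * X i.+1 - s i * X i], after each [X ^+ 2]
    is replaced by [phi 2 X + 1]. Pattern [(0, 0)] carries the mean, which is subtracted. *)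
Definition inc_support : seq (nat * nat) := [:: (0, 2); (2, 0); (0, 1); (1, 0); (1, 1)]%N.

Definition inc_coef (i : nat) (u : nat * nat) : R :=
  match u with
  | (0, 2)%N => s i.+1 ^+ 2
  | (2, 0)%N => s i ^+ 2
  | (0, 1)%N => 2 * dl i * s i.+1
  | (1, 0)%N => - (2 * dl i * s i)
  | (1, 1)%N => - (2 * s i * s i.+1)
  | _ => 0
  end.

Lemma inc_support_gt0 u : u \in inc_support -> (0 < u.1 + u.2)%N.
Proof. by rewrite !inE => /or4P[/eqP->|/eqP->|/eqP->|/orP[/eqP->|/eqP->]]. Qed.

Lemma inc_coef_le (M1 M2 : R) i u : 0 <= M1 -> 0 <= M2 ->
  (forall m, s m ^+ 2 <= M1) -> (forall m, dl m ^+ 2 <= M2) ->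
  `|inc_coef i u| <= M2 + 2 * M1.
Proof.
move=> M1_0 M2_0 hs hd.
have h0 : 0 <= M2 + 2 * M1 by lra.
have sq m : `|s m ^+ 2| <= M2 + 2 * M1.
  by rewrite ger0_norm ?sqr_ge0//; have := hs m; lra.
have cross x y : x ^+ 2 <= M2 -> y ^+ 2 <= M1 -> `|2 * x * y| <= M2 + 2 * M1.
  move=> hx hy; rewrite ler_norml; have := sqr_ge0 (x - y); have := sqr_ge0 (x + y).
  by move=> h1 h2; apply/andP; split; nra.
have cross' x y : x ^+ 2 <= M1 -> y ^+ 2 <= M1 -> `|2 * x * y| <= M2 + 2 * M1.
  move=> hx hy; rewrite ler_norml; have := sqr_ge0 (x - y); have := sqr_ge0 (x + y).
  by move=> h1 h2; apply/andP; split; nra.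
by case: u => [[|[|[|u]]] [|[|[|v]]]] /=; rewrite ?normr0 ?normrN//;
  [exact: cross|exact: cross|exact: cross'].
Qed.

Lemma Zsum_increment i w : (i < n)%N ->
  Zsum X n inc_support inc_coef i w =
  (dl i + s i.+1 * X i.+1 w - s i * X i w) ^+ 2
  - (s i ^+ 2 + s i.+1 ^+ 2 + dl i ^+ 2).
Proof.
move=> lt_in; rewrite /Zsum /inc_support !big_cons big_nil !tensor_pat//=.
ring.
Qed.

End increments.

Section l2_bound.
Context d (T : measurableType d) (R : realType) (P : probability T R).

(** Pointwise [(q + 2 L + Q)^2 <= 3 (q^2 + 4 L^2 + Q^2)], whence the constants 3, 12 and 3. *)
Lemma integral_sqr_sum3_le (q l k : R) (L Q Y : T -> R) :
  measurable_fun setT L -> measurable_fun setT Q ->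
  P.-integrable setT (fun w => (L w ^+ 2)%:E) ->
  P.-integrable setT (fun w => (Q w ^+ 2)%:E) ->
  (forall w, Y w = q + 2 * L w + Q w) ->
  \int[P]_w (L w ^+ 2) <= l -> \int[P]_w (Q w ^+ 2) <= k ->
  (\int[P]_w (Y w ^+ 2)%:E <= (3 * q ^+ 2 + 12 * l + 3 * k)%:E)%E.
Proof.
move=> mL mQ iL iQ YE hl hk.
have mY : measurable_fun setT Y.
  have E : Y = (fun w => q + 2 * L w + Q w) by apply/funext => w; exact: YE.
  rewrite E.
  apply: measurable_funD => //; apply: measurable_funD; first exact: measurable_cst.
  by apply: measurable_funM => //; exact: measurable_cst.
have iL' : P.-integrable setT (EFin \o (fun w => 12 * L w ^+ 2)).
  exact: (integrableZl measurableT 12 iL).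
have iQ' : P.-integrable setT (EFin \o (fun w => 3 * Q w ^+ 2)).
  exact: (integrableZl measurableT 3 iQ).
have ic : P.-integrable setT (EFin \o (fun=> 3 * q ^+ 2 : R)).
  exact: finite_measure_integrable_cst.
have iLQ : P.-integrable setT (EFin \o (fun w => 12 * L w ^+ 2 + 3 * Q w ^+ 2)).
  exact: (integrableD measurableT iL' iQ').
have iG : P.-integrable setT
    (EFin \o (fun w => 3 * q ^+ 2 + (12 * L w ^+ 2 + 3 * Q w ^+ 2))).
  exact: (integrableD measurableT ic iLQ).
apply: (@le_trans _ _ (\int[P]_w (3 * q ^+ 2 + (12 * L w ^+ 2 + 3 * Q w ^+ 2))%:E)%E).
  apply: ge0_le_integral => //.
  - by move=> w _; rewrite lee_fin sqr_ge0.
  - by apply/measurable_EFinP; exact: measurable_funX.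
  - exact: measurable_int iG.
  - move=> w _; rewrite lee_fin YE.
    move: (L w) (Q w) => x y.
    have := sqr_ge0 (q - 2 * x); have := sqr_ge0 (q - y); have := sqr_ge0 (2 * x - y).
    nra.
rewrite -(fineK (integrable_fin_num measurableT iG)) lee_fin.
rewrite -/(Rintegral P setT (fun w => 3 * q ^+ 2 + (12 * L w ^+ 2 + 3 * Q w ^+ 2))).
rewrite RintegralD// RintegralD// Rintegral_cst_prob !RintegralZl//.
by rewrite -addrA lerD2l lerD// ler_pM2l.
Qed.

End l2_bound.

Section statistic.
Context d (T : measurableType d) (R : realType) (P : probability T R).
Variable X : nat -> T -> R.
Hypothesis mX : forall i, measurable_fun setT (X i).
Hypothesis iX : mutually_independent P X.
Hypothesis idX : identically_distributed P X.
Hypothesis X1 : (\int[P]_w (X 0%N w)%:E = 0)%E.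
Hypothesis X2 : (\int[P]_w ((X 0%N w) ^+ 2)%:E = 1)%E.
Hypothesis X4 : (\int[P]_w ((X 0%N w) ^+ 4)%:E < +oo)%E.

Lemma measurable_Zsum n U (c : nat -> nat * nat -> R) i :
  measurable_fun setT (Zsum X n U c i).
Proof.
apply: measurable_sum => u; apply: measurable_funM; first exact: measurable_cst.
apply: measurable_prod => m _.
by apply: measurableT_comp => //; exact: measurable_phi.
Qed.

Variables (K : R -> R) (h : R) (f V : R -> R) (n : nat) (M : R).
Hypothesis n0 : (0 < n)%N.
Hypothesis V0 : forall m, (m <= n)%N -> 0 <= V (m%:R / n%:R) <= M.
Hypothesis df : forall i, (i < n)%N -> `|deltai f n i| <= M.

Let M0 : 0 <= M.
Proof. by have /andP[h1 h2] := V0 (leq0n n); exact: le_trans h2. Qed.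

(* Truncated outside of the observed range so that the coefficients are
   bounded for every index. *)
Definition sdev (m : nat) : R :=
  if (m <= n)%N then Num.sqrt (V (m%:R / n%:R)) else 0.
Definition drift (i : nat) : R := if (i < n)%N then deltai f n i else 0.

Local Notation Z := (Zsum X n inc_support (inc_coef sdev drift)).
Definition sqmean (i : 'I_n) : R := Wi V n i + deltai f n i ^+ 2.
Local Notation kapm := (fun i j : 'I_n => Knh K n h (i%:Z - j%:Z)).

(** The bound of [inc_coef_le] for variances at most [M] and squared drifts at most [M ^+ 2]. *)
Definition coef_bound : R := M ^+ 2 + 2 * M.

Lemma sdev2 m : (m <= n)%N -> sdev m ^+ 2 = V (m%:R / n%:R).
Proof. by move=> mn; rewrite /sdev mn sqr_sqrtr//; have /andP[] := V0 mn. Qed.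

Lemma inc_coef_bound i u : `|inc_coef sdev drift i u| <= coef_bound.
Proof.
apply: inc_coef_le => //; first exact: sqr_ge0.
- move=> m; have [mn|nm] := leqP m n; first by rewrite sdev2//; have /andP[] := V0 mn.
  by rewrite /sdev leqNgt nm expr0n.
- move=> m; rewrite /drift; case: ifPn => [mn|_]; last by rewrite expr0n/= sqr_ge0.
  by rewrite -real_normK ?num_real// lerXn2r ?nnegrE ?normr_ge0 ?M0// df.
Qed.

Lemma Rdiff_sqr (i : 'I_n) w : Rdiff f V X n i w ^+ 2 = sqmean i + Z i w.
Proof.
have lt_in := ltn_ord i; rewrite Zsum_increment// !sdev2//; last exact: ltnW.
rewrite /sqmean /Wi /Rdiff /Yobs /sdev /drift lt_in (ltnW lt_in).
by rewrite /deltai; ring.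
Qed.

Lemma That_centered w :
  That K h f V X n w =
  \sum_(i < n) \sum_(j < n) acoef kapm i j * ((sqmean i + Z i w) * (sqmean j + Z j w)).
Proof.
rewrite /That !mulr_sumr -sumrN -big_split/=; apply: eq_bigr => i _.
rewrite !mulr_sumr -sumrN -big_split/= big_mkcond/=; apply: eq_bigr => j _.
by rewrite /acoef !Rdiff_sqr; case: ifP => _; [ring|rewrite mul0r].
Qed.

Lemma Tstat_sqmean : Tstat f V n =
  n%:R^-1 * \sum_(i < n) (sqmean i - n%:R^-1 * \sum_(j < n) sqmean j) ^+ 2.
Proof.
rewrite /Tstat; congr (_ * _); apply: eq_bigr => i _.
by rewrite /sqmean [in RHS]big_split/= mulrDr; congr (_ ^+ 2); ring.
Qed.

Lemma mse_le (kap_sym : forall i j, kapm i j = kapm j i) :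
  (\int[P]_w ((That K h f V X n w - Tstat f V n) ^+ 2)%:E <=
   (3 * (\sum_(i < n) \sum_(j < n) acoef kapm i j * (sqmean i * sqmean j)
         - Tstat f V n) ^+ 2
    + 12 * (Zsum_bound2 P X inc_support coef_bound * 3%:R *
            \sum_i (\sum_j acoef kapm i j * sqmean j) ^+ 2)
    + 3 * (Zsum_bound4 P X inc_support coef_bound * 18%:R *
            \sum_(s : 'I_n * 'I_n) acoef kapm s.1 s.2 ^+ 2))%:E)%E.
Proof.
pose a i j := acoef kapm i j.
pose L w := \sum_(i < n) (\sum_j a i j * sqmean j) * Z i w.
pose Q w := \sum_(s : 'I_n * 'I_n) a s.1 s.2 *
  Zpair X inc_support (inc_coef sdev drift) s w.
have asym i j : a i j = a j i by rewrite /a /acoef far_sym kap_sym.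
have QE w : Q w = \sum_(i < n) \sum_(j < n) a i j * (Z i w * Z j w).
  rewrite pair_bigA/=; apply: eq_bigr => s _; rewrite /Zpair.
  by case: ifPn => // ns; rewrite /a /acoef (negbTE ns) !mul0r.
have sup := @inc_support_gt0; have cb := inc_coef_bound.
apply: (@integral_sqr_sum3_le _ _ _ _ _ _ _ L Q).
- apply: measurable_sum => i; apply: measurable_funM; first exact: measurable_cst.
  exact: measurable_Zsum.
- apply: measurable_sum => s; apply: measurable_funM; first exact: measurable_cst.
  rewrite /Zpair; case: (far s.1 s.2); last exact: measurable_cst.
  by apply: measurable_funM; exact: measurable_Zsum.
- apply: (integrable_mul_lin _ _ _ _ (fun i j : 'I_n => integrable_Zsum2 mX iX idX X4 n _ _ i j)).
- apply: (integrable_mul_lin _ _ _ _ (fun s t => integrable_Zpair mX iX idX X4 _ _ s t)).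
- move=> w; rewrite That_centered (expand_centered _ _ asym) QE.
  by rewrite /L /a; ring.
- exact: (linear_part_le mX iX idX X1 X2 X4 sup cb).
- exact: (quadratic_part_le mX iX idX X1 X2 X4 sup cb).
Qed.

End statistic.

(** The difference of the two sides is [n (b - v)^2], with [b] the mean. This lets the grid mean be
    replaced by a multiple of the integral of [V], so the two never have to be compared. *)
Lemma sum_sqr_centered_le (R : realType) (n : nat) (m : 'I_n -> R) (v : R) : (0 < n)%N ->
  \sum_(i < n) (m i - n%:R^-1 * \sum_(j < n) m j) ^+ 2 <= \sum_(i < n) (m i - v) ^+ 2.
Proof.
move=> n0; have N0 : n%:R != 0 :> R by rewrite pnatr_eq0 -lt0n.
have sm : \sum_(j < n) m j = n%:R * (n%:R^-1 * \sum_(j < n) m j) by rewrite mulVKf.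
move: sm; set b := n%:R^-1 * _ => sm; clearbody b.
rewrite -subr_ge0 -sumrB.
have -> : \sum_(i < n) ((m i - v) ^+ 2 - (m i - b) ^+ 2) =
    2 * (b - v) * \sum_(i < n) m i + \sum_(i < n) (v ^+ 2 - b ^+ 2).
  by rewrite mulr_sumr -big_split/=; apply: eq_bigr => i _; ring.
have e : \sum_(i < n) (v ^+ 2 - b ^+ 2) = n%:R * (v ^+ 2 - b ^+ 2).
  by rewrite sumr_const card_ord [RHS]mulr_natl.
rewrite sm e.
have -> : 2 * (b - v) * (n%:R * b) + n%:R * (v ^+ 2 - b ^+ 2) = n%:R * (b - v) ^+ 2 by ring.
by rewrite mulr_ge0// sqr_ge0.
Qed.

(** * Adding up the rates *)

Section rate_assembly.
Variables (R : realFieldType) (r i H hb D w I Bm M Ch Chb : R).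
Hypothesis i0 : 0 <= i.
Hypothesis i1 : i <= 1.
Hypothesis r0 : 0 <= r.
Hypothesis H2 : H ^+ 2 <= Ch ^+ 2 * r.
Hypothesis hb4 : hb ^+ 4 <= Chb ^+ 4 * r.
Hypothesis D4 : D ^+ 4 <= M ^+ 8 * r.
Hypothesis i2 : i ^+ 2 <= r.
Hypothesis iw : i * w ^+ 2 <= r.
Hypothesis iI : i * I <= r.

(** Here [i], [H], [hb], [D], [w], [I] stand for [1 / n], [h], [h^beta], the bound on [delta_i^2],
    [n^(-beta)] and the squared norm of [V - Vbar], and [r] for the whole right-hand side of the
    theorem. The 128 is [8 * 16], from [(s + t)^4 <= 8 (s^4 + t^4)] with [s = 2 M hb]. *)
Lemma bias_rate (b : R) :
  `|b| <= Bm ^+ 2 * H + (2 * M * hb + D) ^+ 2 / 2 + 3 * Bm ^+ 2 * i ->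
  b ^+ 2 <= 3 * (Bm ^+ 4 * Ch ^+ 2 + (128 * (M ^+ 4 * Chb ^+ 4) + 8 * M ^+ 8) / 4
                 + 9 * Bm ^+ 4) * r.
Proof.
set x := Bm ^+ 2 * H; set y := (2 * M * hb + D) ^+ 2 / 2; set z := 3 * Bm ^+ 2 * i.
move=> bxyz.
have b2 : b ^+ 2 <= (x + y + z) ^+ 2.
  by rewrite -real_normK ?num_real// lerXn2r ?nnegrE// (le_trans (normr_ge0 b)).
have h3 : (x + y + z) ^+ 2 <= 3 * (x ^+ 2 + y ^+ 2 + z ^+ 2).
  have := sqr_ge0 (x - y); have := sqr_ge0 (x - z); have := sqr_ge0 (y - z); nra.
have B4 : 0 <= Bm ^+ 4 by rewrite -[4%N]/(2 * 2)%N exprM sqr_ge0.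
have M4 : 0 <= M ^+ 4 by rewrite -[4%N]/(2 * 2)%N exprM sqr_ge0.
have x2 : x ^+ 2 <= Bm ^+ 4 * (Ch ^+ 2 * r).
  by rewrite /x exprMn -exprM ler_wpM2l.
have z2 : z ^+ 2 <= 9 * Bm ^+ 4 * r.
  rewrite /z (_ : (_ * i) ^+ 2 = 9 * Bm ^+ 4 * i ^+ 2); last by ring.
  by rewrite ler_wpM2l// mulr_ge0.
have y2 : y ^+ 2 <= (128 * (M ^+ 4 * (Chb ^+ 4 * r)) + 8 * (M ^+ 8 * r)) / 4.
  rewrite /y (_ : (_ / 2) ^+ 2 = (2 * M * hb + D) ^+ 4 / 4); last by field.
  rewrite ler_pM2r ?invr_gt0//.
  have q4 (s t : R) : (s + t) ^+ 4 <= 8 * (s ^+ 4 + t ^+ 4).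
    have st : (s + t) ^+ 2 <= 2 * (s ^+ 2 + t ^+ 2) by have := sqr_ge0 (s - t); nra.
    have e4 (u : R) : u ^+ 4 = (u ^+ 2) ^+ 2 by rewrite -exprM.
    rewrite !e4; apply: (@le_trans _ _ ((2 * (s ^+ 2 + t ^+ 2)) ^+ 2)).
      by rewrite lerXn2r ?nnegrE ?sqr_ge0// mulr_ge0// addr_ge0// sqr_ge0.
    by have := sqr_ge0 (s ^+ 2 - t ^+ 2); nra.
  apply: le_trans (q4 _ _) _; rewrite mulrDr lerD ?ler_pM2l//.
  have -> : (2 * M * hb) ^+ 4 = 16 * (M ^+ 4 * hb ^+ 4) by ring.
  have -> : 8 * (16 * (M ^+ 4 * hb ^+ 4)) = 128 * (M ^+ 4 * hb ^+ 4) by ring.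
  by rewrite ler_pM2l// ler_wpM2l.
have := le_trans b2 h3; nra.
Qed.

(** The mixed terms [i * D ^+ 2] and [i * H] are reduced to [i ^+ 2], [D ^+ 4] and [H ^+ 2] by the
    arithmetic-geometric mean inequality, since only these powers are known to be below [r]. *)
Lemma linear_rate (t s : R) :
  0 <= H -> 0 <= D -> t <= 3 * (4 * I + 4 * (M * w) ^+ 2 + D ^+ 2) ->
  s <= 3 * (i * t + Bm ^+ 2 * (i * H) + 9 * Bm ^+ 2 * i ^+ 3) ->
  s <= 3 * (12 + 12 * M ^+ 2 + 3 / 2 * (1 + M ^+ 8) + Bm ^+ 2 * ((1 + Ch ^+ 2) / 2)
            + 9 * Bm ^+ 2) * r.
Proof.
move=> H0 D0 ht hs.
have it : i * t <= 12 * (i * I) + 12 * M ^+ 2 * (i * w ^+ 2) + 3 * (i * D ^+ 2).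
  by apply: le_trans (ler_wpM2l i0 ht) _; rewrite le_eqVlt; apply/orP; left; apply/eqP; ring.
have iD : i * D ^+ 2 <= (1 + M ^+ 8) / 2 * r.
  have k : 2 * (i * D ^+ 2) <= i ^+ 2 + D ^+ 4.
    have -> : D ^+ 4 = (D ^+ 2) ^+ 2 by rewrite -exprM.
    by have := sqr_ge0 (i - D ^+ 2); move: (D ^+ 2) => d2; nra.
  move: k D4 i2; move: (i * D ^+ 2) (D ^+ 4) (M ^+ 8) (i ^+ 2) => u1 u2 u3 u4; nra.
have iH : i * H <= (1 + Ch ^+ 2) / 2 * r.
  have k : 2 * (i * H) <= i ^+ 2 + H ^+ 2 by have := sqr_ge0 (i - H); nra.
  move: k H2 i2; move: (i * H) (H ^+ 2) (Ch ^+ 2) (i ^+ 2) => u1 u2 u3 u4; nra.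
have i3 : i ^+ 3 <= r.
  by apply: le_trans i2; rewrite exprS; apply: ler_piMl => //; exact: sqr_ge0.
have M2 : 0 <= 12 * M ^+ 2 by rewrite mulr_ge0// sqr_ge0.
have B2 : 0 <= Bm ^+ 2 by exact: sqr_ge0.
have h1 := ler_wpM2l M2 iw; have h2 := ler_wpM2l B2 iH; have h3 := ler_wpM2l B2 i3.
apply: le_trans hs _.
rewrite (_ : 3 * _ * r = 3 * ((12 * r + 12 * M ^+ 2 * r + 3 * ((1 + M ^+ 8) / 2 * r))
   + Bm ^+ 2 * ((1 + Ch ^+ 2) / 2 * r) + 9 * (Bm ^+ 2 * r))); last by field.
rewrite ler_pM2l// -(mulrA 9).
apply: lerD; last by rewrite ler_pM2l.
apply: lerD => //; apply: le_trans it _.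
apply: lerD; last by rewrite ler_pM2l.
by apply: lerD => //; rewrite ler_pM2l.
Qed.

Lemma quadratic_rate (c q Kb : R) : 0 < c -> i * Kb <= 2 / c * (Ch^-1 * r) ->
  q <= 2 * (i * Kb) + 2 * i ^+ 2 -> q <= (4 / c / Ch + 2) * r.
Proof.
move=> c0 h1 h2; apply: le_trans h2 _.
have -> : (4 / c / Ch + 2) * r = 2 * (2 / c * (Ch^-1 * r)) + 2 * r by ring.
by apply: lerD; rewrite ler_pM2l.
Qed.

End rate_assembly.

(** * Means of the squared increments under smoothness *)

Section model.
Variables (R : realType) (alpha beta M : R) (f V : R -> R) (n : nat).
Hypothesis a0 : 0 < alpha.
Hypothesis b0 : 0 < beta.
Hypothesis b1 : beta < 1.
Hypothesis M0 : 0 < M.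
Hypothesis hf : holder alpha M f.
Hypothesis hV : holder beta M V.
Hypothesis V0 : forall x, 0 <= x <= 1 -> 0 <= V x.
Hypothesis n0 : (0 < n)%N.

Local Notation p := (n%:R : R).
Local Notation D := (M ^+ 2 * (p^-1 `^ Num.min alpha 1) ^+ 2).

Let p0 : 0 < p. Proof. by rewrite ltr0n. Qed.

Lemma grid01 m : (m <= n)%N -> 0 <= m%:R / p <= 1.
Proof. by move=> mn; rewrite divr_ge0//= ler_pdivrMr// mul1r ler_nat. Qed.

Lemma grid_V m : (m <= n)%N -> 0 <= V (m%:R / p) <= M.
Proof.
move=> mn; have g := grid01 mn; rewrite V0//=.
exact: le_trans (ler_norm _) (holder_bound hV g).
Qed.

Let inv_powR_le1 (a : R) : 0 <= a -> p^-1 `^ a <= 1.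
Proof.
move=> a_ge0; rewrite -[leRHS](powRr0 p^-1); apply: ger_powR => //.
by rewrite invr_gt0 p0 invf_le1// ler1n.
Qed.

Lemma min1_gt0 : 0 < Num.min alpha 1.
Proof. by rewrite lt_min a0 ltr01. Qed.

Lemma deltai_le i : (i < n)%N -> `|deltai f n i| <= M * p^-1 `^ Num.min alpha 1.
Proof.
move=> lt_in; have g1 := grid01 lt_in; have g2 := grid01 (ltnW lt_in).
apply: le_trans (holder_min1 a0 (ltW M0) hf g1 g2) _.
rewrite -natr1 mulrDl mul1r addrAC subrr add0r ger0_norm// invr_ge0 ltW//.
Qed.

Lemma deltai_le_M i : (i < n)%N -> `|deltai f n i| <= M.
Proof.
move=> lt_in; apply: le_trans (deltai_le lt_in) _.
by rewrite ler_piMr ?(ltW M0)// inv_powR_le1// ltW// min1_gt0.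
Qed.

Lemma deltai_sqr i : (i < n)%N -> 0 <= deltai f n i ^+ 2 <= D.
Proof.
move=> lt_in; rewrite sqr_ge0 -exprMn/=; have h := deltai_le lt_in.
by rewrite -real_normK ?num_real// lerXn2r ?nnegrE// (le_trans (normr_ge0 _) h).
Qed.

Lemma D_bounds : 0 <= D <= M ^+ 2.
Proof.
rewrite mulr_ge0 ?sqr_ge0//= ler_piMr ?sqr_ge0//.
by rewrite expr_le1// ?powR_ge0// inv_powR_le1// ltW// min1_gt0.
Qed.

Lemma sqmean_le (i : 'I_n) : `|sqmean f V i| <= 2 * M + M ^+ 2.
Proof.
have lt_in := ltn_ord i; have /andP[d1 d2] := deltai_sqr lt_in.
have /andP[_ d3] := D_bounds.
have /andP[v1 v2] := grid_V lt_in; have /andP[v3 v4] := grid_V (ltnW lt_in).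
rewrite ger0_norm /sqmean /Wi; last by rewrite !addr_ge0.
by have := le_trans d2 d3; lra.
Qed.

Lemma sqmean_dist (h : R) (i j : 'I_n) : `|i%:R - j%:R| <= p * h ->
  `|sqmean f V i - sqmean f V j| <= 2 * M * h `^ beta + D.
Proof.
move=> ijh; have li := ltn_ord i; have lj := ltn_ord j.
have Vd k l : (k <= n)%N -> (l <= n)%N -> `|k%:R - l%:R| <= p * h ->
    `|V (k%:R / p) - V (l%:R / p)| <= M * h `^ beta.
  move=> kn ln kl.
  apply: le_trans (holder_lt1 b0 b1 hV (grid01 kn) (grid01 ln)) _.
  have klh : `|k%:R / p - l%:R / p| <= h.
    by rewrite -mulrBl normrM (gtr0_norm (x := p^-1)) ?invr_gt0// ler_pdivrMr// mulrC.
  rewrite ler_pM2l//; apply: ge0_ler_powR => //; first exact: ltW.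
  by rewrite nnegrE (le_trans (normr_ge0 _) klh).
have h1 := Vd i j (ltnW li) (ltnW lj) ijh.
have h2 : `|V (i.+1%:R / p) - V (j.+1%:R / p)| <= M * h `^ beta.
  by apply: Vd => //; rewrite -!natr1 opprD addrACA subrr addr0.
have /andP[d1 d2] := deltai_sqr li; have /andP[d3 d4] := deltai_sqr lj.
rewrite /sqmean /Wi; move: h1 h2; rewrite !ler_norml => /andP[h1 h1'] /andP[h2 h2'].
by apply/andP; split; lra.
Qed.

(** The centre is [2 v] because [Wi] adds two values of [V]. The 3 splits the square into two [V]
    parts and the drift, and the two Riemann sums contribute 2 each to the factors 4. *)
Lemma sqmean_variance (v : R) :
  p^-1 * \sum_(i < n) (sqmean f V i - p^-1 * \sum_(j < n) sqmean f V j) ^+ 2 <=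
  3 * (4 * intab 0 1 (fun x => (V x - v) ^+ 2) + 4 * (M * p^-1 `^ beta) ^+ 2 + D ^+ 2).
Proof.
pose A := \sum_(j < n) (V (j%:R / p) - v) ^+ 2.
pose B := \sum_(j < n) (V (j.+1%:R / p) - v) ^+ 2.
have hA := @riemann_holder R beta M v V b0 b1 M0 hV n (fun j => j%:R / p) n0.
have hB := @riemann_holder R beta M v V b0 b1 M0 hV n (fun j => j.+1%:R / p) n0.
have le1 j : j%:R / p <= j.+1%:R / p by rewrite ler_pM2r ?invr_gt0// ler_nat.
have {}hA := hA (fun j _ => introT andP (conj (lexx _) (le1 j))).
have {}hB := hB (fun j _ => introT andP (conj (le1 j) (lexx _))).
have S : \sum_(i < n) (sqmean f V i - p^-1 * \sum_(j < n) sqmean f V j) ^+ 2 <=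
    3 * (A + B + p * D ^+ 2).
  apply: le_trans (sum_sqr_centered_le _ (2 * v) n0) _.
  have -> : p * D ^+ 2 = \sum_(j < n) D ^+ 2 by rewrite sumr_const card_ord [LHS]mulr_natl.
  rewrite -!big_split/= mulr_sumr; apply: ler_sum => i _.
  have /andP[d1 d2] := deltai_sqr (ltn_ord i).
  have dd : (deltai f n i ^+ 2) ^+ 2 <= D ^+ 2 by rewrite lerXn2r ?nnegrE// (le_trans d1).
  move: dd; rewrite /sqmean /Wi.
  move: (V (i%:R / p)) (V (i.+1%:R / p)) (deltai f n i ^+ 2) (D ^+ 2) => x y z t zt.
  have := sqr_ge0 ((x - v) - (y - v)); have := sqr_ge0 ((x - v) - z).
  have := sqr_ge0 ((y - v) - z); nra.
have : p^-1 * \sum_(i < n) (sqmean f V i - p^-1 * \sum_(j < n) sqmean f V j) ^+ 2 <=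
    3 * (p^-1 * A + p^-1 * B + D ^+ 2).
  rewrite [leRHS](_ : _ = p^-1 * (3 * (A + B + p * D ^+ 2))); last by field; rewrite gt_eqF.
  by rewrite ler_pM2l// invr_gt0.
move/le_trans; apply; rewrite ler_pM2l// lerD2r.
by move: hA hB; rewrite -/A -/B; move: (p^-1 * A) (p^-1 * B) => x y hx hy; lra.
Qed.

End model.

Theorem theorem2p3 (R : realType) (alpha beta M : R) (K : R -> R) :
  0 < alpha -> 0 < beta -> beta < 2^-1 -> 0 < M -> is_kernel K ->
  exists Ch0 : R, 0 < Ch0 /\
  forall Ch : R, Ch0 <= Ch ->
  forall (d : measure_display) (T : measurableType d) (P : probability T R)
         (xi : nat -> T -> R),
    (forall i, measurable_fun setT (xi i)) ->
    mutually_independent P xi ->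
    identically_distributed P xi ->
    (\int[P]_w (xi 0%N w)%:E = 0)%E ->
    (\int[P]_w ((xi 0%N w) ^+ 2)%:E = 1)%E ->
    (\int[P]_w ((xi 0%N w) ^+ 4)%:E < +oo)%E ->
  exists C : R, 0 < C /\
  forall (n : nat) (f V : R -> R),
    (1 <= n)%N ->
    holder alpha M f -> holder beta M V ->
    (forall x, 0 <= x <= 1 -> 0 <= V x) ->
    let h := Ch * n%:R `^ (- Num.min (2 / (4 * beta + 1)) 1) in
    let Vbar := intab 0 1 V in
    (\int[P]_w ((That K h f V xi n w - Tstat f V n) ^+ 2)%:E
      <= (C * (n%:R `^ (- (8 * alpha)) + n%:R `^ (- (4 * beta))
               + n%:R `^ (- (8 * beta / (4 * beta + 1)))
               + intab 0 1 (fun x => (V x - Vbar) ^+ 2) / n%:R))%:E)%E.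
Proof.
move=> a0 b0 b2 M0 [mK Kout Ksym [c [c0 Kc]] K1].
have b1 : beta < 1 by lra.
(* Since [n h >= Ch], this threshold keeps the denominator of the kernel weights at least one half
   for every [n]. *)
exists (8 / c); split; first by rewrite divr_gt0.
move=> Ch hCh d T P X mX iX idX X1 X2 X4.
have Ch_gt0 : 0 < Ch by apply: lt_le_trans hCh; rewrite divr_gt0.
pose Bm := 2 * M + M ^+ 2.
pose Cb := 3 * (Bm ^+ 4 * Ch ^+ 2
   + (128 * (M ^+ 4 * (Ch `^ beta) ^+ 4) + 8 * M ^+ 8) / 4 + 9 * Bm ^+ 4).
pose Cl := 3 * (12 + 12 * M ^+ 2 + 3 / 2 * (1 + M ^+ 8) + Bm ^+ 2 * ((1 + Ch ^+ 2) / 2)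
            + 9 * Bm ^+ 2).
pose Cq := 4 / c / Ch + 2.
pose C2 := Zsum_bound2 P X inc_support (coef_bound M).
pose C4 := Zsum_bound4 P X inc_support (coef_bound M).
have Bm0 : 0 <= Bm by rewrite addr_ge0 ?mulr_ge0 ?sqr_ge0// ltW.
have cb0 : 0 <= coef_bound M by rewrite addr_ge0 ?mulr_ge0 ?sqr_ge0// ltW.
have C2_ge0 : 0 <= C2.
  by rewrite mulr_ge0 ?exprn_ge0// mulr_ge0 ?exprn_ge0// (le_trans ler01)// phi_bound_ge1.
have C4_ge0 : 0 <= C4.
  by rewrite mulr_ge0 ?exprn_ge0// mulr_ge0 ?exprn_ge0// (le_trans ler01)// phi_bound_ge1.
have M8 : 0 <= M ^+ 8 by rewrite exprn_ge0// ltW.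
have Cb_ge0 : 0 <= Cb.
  have h1 : 0 <= Bm ^+ 4 * Ch ^+ 2 by rewrite mulr_ge0 ?exprn_ge0 ?(ltW Ch_gt0).
  have h2 : 0 <= M ^+ 4 * (Ch `^ beta) ^+ 4 by rewrite mulr_ge0 ?exprn_ge0 ?powR_ge0 ?(ltW M0).
  have h3 : 0 <= Bm ^+ 4 by rewrite exprn_ge0.
  by rewrite /Cb; lra.
have Cl_ge0 : 0 <= Cl.
  have h1 : 0 <= Bm ^+ 2 * ((1 + Ch ^+ 2) / 2) by rewrite mulr_ge0 ?sqr_ge0// divr_ge0 ?addr_ge0 ?sqr_ge0.
  have h2 := sqr_ge0 Bm; have h3 := sqr_ge0 M.
  by rewrite /Cl; lra.
have Cq_ge0 : 0 <= Cq by rewrite addr_ge0// !divr_ge0// ltW.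
(* Here [36 = 12 * 3] and [54 = 3 * 18] combine the factors of [mse_le] with those of the two
   variance bounds; the final 1 secures positivity. *)
exists (3 * Cb + 36 * C2 * Cl + 54 * C4 * Cq + 1); split.
  by have := mulr_ge0 C2_ge0 Cl_ge0; have := mulr_ge0 C4_ge0 Cq_ge0; nra.
move=> n f V n0 hf hV V0; lazy zeta.
set h := Ch * _; set Vbar := intab 0 1 V.
set I := intab 0 1 _; set r := (X in (_ * X)%:E).
have p0 : 0 < n%:R :> R by rewrite ltr0n.
have h0 : 0 < h by rewrite mulr_gt0// powR_gt0.
have I0 : 0 <= I by apply: Rintegral_ge0 => x _; exact: sqr_ge0.
set r1 := n%:R `^ (- (8 * alpha)); set r2 := n%:R `^ (- (4 * beta)) in r *.
have nhCh : Ch <= n%:R * h by exact: rate_nh_ge.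
have nh : 8 / c <= n%:R * h by exact: le_trans nhCh.
have n_h0 : 0 <= n%:R * h by rewrite mulr_ge0// ltW.
pose kapm (i j : 'I_n) := Knh K n h (i%:Z - j%:Z).
have kapE i j : kapm i j = kap K n h `|i%:Z - j%:Z|%N by exact: Knh_kap.
have kge0 m : 0 <= kap K n h m by exact: (kap_ge0 mK Kout Ksym c0 Kc n0 nh).
have khalf m := sum_kap_le mK Kout Ksym c0 Kc K1 n0 nh m.
have kfull m := sum_kap_eq mK Kout Ksym c0 Kc K1 n0 nh (m := m).
have ksym i j : kapm i j = kapm j i by rewrite !kapE distnC.
have kpos i j : 0 <= kapm i j by rewrite kapE.
have knear (i j : 'I_n) : ~~ far i j -> kapm i j = 0.
  by rewrite kapE /far -ltnNge; exact: kap_lt2.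
have kle i j : kapm i j <= 2 / c / (n%:R * h).
  by rewrite kapE; exact: (kap_le mK Kout Ksym c0 Kc n0 nh).
have k00 : kap K n h 0 = 0 by exact: kap_lt2.
have krow i : \sum_j kapm i j <= 1.
  by under eq_bigr do rewrite kapE; exact: row_sum_le1.
have kdef : \sum_i (1 - \sum_j kapm i j) <= n%:R * h.
  under eq_bigr do under eq_bigr do rewrite kapE.
  exact: row_defect_le.
have mle := sqmean_le a0 M0 hf hV V0 n0; rewrite -/Bm in mle.
have mdist i j : kapm i j != 0 ->
    `|sqmean f V i - sqmean f V j| <= 2 * M * h `^ beta +
      M ^+ 2 * (n%:R^-1 `^ Num.min alpha 1) ^+ 2.
  (* By contraposition: at a distance above [n h] the weight vanishes by [kap_support]. *)
  move=> kij; apply: (sqmean_dist a0 b0 b1 M0 hf hV n0).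
  rewrite leNgt; apply/negP => hij; move/eqP: kij; apply; rewrite kapE.
  apply: (kap_support mK Kout Ksym c0 Kc K1 n0 nh).
  apply: ltW; apply: lt_le_trans hij _.
  by rewrite natr_absz intr_norm rmorphB/= lexx.
have df i : (i < n)%N -> `|deltai f n i| <= M by exact: (deltai_le_M a0 M0 hf n0).
have gV m : (m <= n)%N -> 0 <= V (m%:R / n%:R) <= M by exact: (grid_V hV V0 n0).
apply: le_trans (mse_le mX iX idX X1 X2 X4 gV df ksym) _; rewrite lee_fin.
have r10 : 0 <= r1 by exact: powR_ge0.
have r20 : 0 <= r2 by exact: powR_ge0.
have r30 : 0 <= n%:R `^ (- (8 * beta / (4 * beta + 1))) :> R by exact: powR_ge0.
have rI0 : 0 <= I / n%:R by rewrite divr_ge0// ltW.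
have r0 : 0 <= r by rewrite /r !addr_ge0.
have r23 : r2 + n%:R `^ (- (8 * beta / (4 * beta + 1))) <= r by rewrite /r -/r1 -/r2; lra.
have r12 : r1 + r2 <= r by rewrite /r -/r1 -/r2; lra.
have r2r : r2 <= r by rewrite /r -/r1 -/r2; lra.
have i0 : 0 <= n%:R^-1 :> R by rewrite invr_ge0 ltW.
have i1 : n%:R^-1 <= 1 :> R by rewrite invf_le1// ler1n.
have H2 : h ^+ 2 <= Ch ^+ 2 * r.
  by apply: le_trans (rate_h2 Ch b0 b2 n0) _; rewrite ler_wpM2l// sqr_ge0.
have hb4 : (h `^ beta) ^+ 4 <= (Ch `^ beta) ^+ 4 * r.
  by apply: le_trans (rate_h4 b0 b2 Ch_gt0 n0) _; rewrite ler_wpM2l// exprn_ge0// powR_ge0.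
have D4 : (M ^+ 2 * (n%:R^-1 `^ Num.min alpha 1) ^+ 2) ^+ 4 <= M ^+ 8 * r.
  by apply: le_trans (rate_delta alpha b0 b2 n0 M) _; rewrite ler_wpM2l.
have i2 : n%:R^-1 ^+ 2 <= r by apply: le_trans r2r; apply: rate_inv2.
have iw : n%:R^-1 * (n%:R^-1 `^ beta) ^+ 2 <= r.
  by apply: le_trans r2r; apply: rate_omega.
have iI : n%:R^-1 * I <= r by rewrite mulrC /r -/r1 -/r2; lra.
have inh : n%:R^-1 * (2 / c / (n%:R * h)) <= 2 / c * (Ch^-1 * r).
  rewrite (_ : _ * _ = 2 / c * (n%:R^-1 / (n%:R * h))); last by ring.
  rewrite ler_pM2l ?divr_gt0//; apply: le_trans (rate_nh b0 b2 Ch_gt0 n0) _.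
  by rewrite ler_pM2l// invr_gt0.
have n_neq0 : n%:R != 0 :> R by rewrite gt_eqF.
have E1 : (\sum_(i < n) \sum_(j < n) acoef kapm i j * (sqmean f V i * sqmean f V j)
    - Tstat f V n) ^+ 2 <= Cb * r.
  apply: (bias_rate H2 hb4 D4 i2).
  (* The total defect [S] is [n h], so division by [n] leaves the [h] that [bias_rate] takes as
     [H]. *)
  have := bias_le n0 ksym kpos knear krow kdef mle mdist.
  rewrite -Tstat_sqmean => /le_trans; apply.
  by rewrite le_eqVlt; apply/orP; left; apply/eqP; field.
have E2 : \sum_(i < n) (\sum_(j < n) acoef kapm i j * sqmean f V j) ^+ 2 <= Cl * r.
  have D0 : 0 <= M ^+ 2 * (n%:R^-1 `^ Num.min alpha 1) ^+ 2 by rewrite mulr_ge0 ?sqr_ge0.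
  have hvar := sqmean_variance a0 b0 b1 M0 hf hV n0 Vbar.
  apply: (linear_rate i0 i1 H2 D4 i2 iw iI (ltW h0) D0 hvar).
  apply: le_trans (linear_coef_le n0 ksym kpos knear krow kdef mle) _.
  rewrite le_eqVlt; apply/orP; left; apply/eqP.
  by move: (\sum_(i < n) (_ - _) ^+ 2) => S; field.
have E3 : \sum_(s : 'I_n * 'I_n) acoef kapm s.1 s.2 ^+ 2 <= Cq * r.
  apply: (quadratic_rate i2 c0 inh).
  apply: le_trans (quad_coef_le n0 kpos kle krow) _.
  rewrite le_eqVlt; apply/orP; left; apply/eqP; field.
  by rewrite n_neq0 !gt_eqF.
have F2 := ler_wpM2l C2_ge0 E2; have F3 := ler_wpM2l C4_ge0 E3.
move: E1 F2 F3; rewrite -/C2 -/C4.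
move: (\sum_(i < n) \sum_(j < n) _ - _) (\sum_i _ ^+ 2) (\sum_(s : 'I_n * 'I_n) _) => t1 t2 t3.
by move=> G1 G2 G3; nra.
Qed.
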